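(* Let $P$ be a metric space and let $\big((M_x)_{x\in P},(\mu_{xy})_{x,y\in P}\big)$ be a strongly approximate action of the pair groupoid $P\times P$, with data $L$, $\varepsilon>0$ and $(a_i,b_i,C_i)_{1\le i\le n}$, $a_i+b_i=2+\varepsilon$, as in the context. Then there exists a unique continuous action $\varphi$ of the Lipschitz fundamental groupoid $\mathcal{G}_P^{\mathrm{Lip}}$ (on the family $(M_x)_{x\in P}$) such that, for Lipschitz paths $\gamma:[0,1]\to P$ and $s,t\in[0,1]$, $$d_{\gamma(s)\gamma(t)}\big(\varphi_{\gamma_{st}},\,\mu_{\gamma(s)\gamma(t)}\big)\le C'|t-s|^{1+\varepsilon},$$ where $\varphi_{\gamma_{st}}$ denotes the value of $\varphi$ on the class of the path $\gamma_{st}$, and which is obtained as the limit in $C_{\gamma(s)\gamma(t)}$ of the compositions $$\mu_{\gamma(s)\gamma(t_1)}\circ\mu_{\gamma(t_1)\gamma(t_2)}\circ\cdots\circ\mu_{\gamma(t_{k-1})\gamma(t)}$$ when the mesh of the subdivision $(s,t_1,\ldots,t_{k-1},t)$ of the interval between $s$ and $t$ tends to zero. One possible constant $C'$ is given by $$C'=2^{1+\varepsilon}e^{L\operatorname{Lip}(\gamma)|t-s|}\left(\sum_{i=1}^n C_i\right)\zeta(2+\varepsilon),$$ where $\zeta$ is the Riemann zeta function. Moreover, the continuous action $\varphi$ satisfies the Lipschitz condition $$\operatorname{Lip}(\varphi_{\gamma_{st}})\le e^{L\operatorname{Lip}(\gamma)|t-s|}.$$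
   Context: An extended metric space is a set with a distance taking values in $[0,+\infty]$ satisfying the usual axioms of a distance; completeness is defined via Cauchy sequences. For a map $h:X\to Y$ between (extended) metric spaces, $\operatorname{Lip}(h)=\sup_{x'\neq x''}d_Y(h(x'),h(x''))/d_X(x',x'')$; $h$ is Lipschitz if $\operatorname{Lip}(h)<+\infty$. Let $(P,d_P)$ be a metric space and $(M_x,d_x)_{x\in P}$ a family of complete metric spaces, possibly in the extended sense. $C_{xy}$ denotes the set of continuous maps from $M_y$ to $M_x$, with the (extended) distance $d_{xy}(h,h')=\sup_{m\in M_y}d_x(h(m),h'(m))$. A strongly approximate action of the pair groupoid $P\times P$ is a family $(\mu_{xy})_{x,y\in P}$ such that: (1) $\mu_{xy}\in C_{xy}$; (2) $\mu_{xx}=\mathrm{Id}_{M_x}$ for all $x\in P$; (3) $\operatorname{Lip}(\mu_{xy})\le 1+f\big(d_P(x,y)\big)$, where $f(\delta)=L\delta$ for a constant $L\ge 0$; (4) there are $\varepsilon>0$, an integer $n\ge1$, positive numbers $a_i,b_i$ ($i=1,\ldots,n$) with $a_i+b_i=2+\varepsilon$, and constants $C_i$ ($i=1,\ldots,n$), such that for all $x,u,v,y\in P$ $$d_{xy}(\mu_{xu}\circ\mu_{uy},\,\mu_{xv}\circ\mu_{vy})\le\big(1+L\,d_P(u,x)\big)\sum_{i=1}^n C_i\,d_P(y,v)^{a_i}d_P(u,v)^{b_i}+\sum_{i=1}^n C_i\,d_P(x,u)^{b_i}d_P(u,v)^{a_i};$$ (5) for any $x,y\in P$ and any ordered collection $(x_0,\ldots,x_k)$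 of elements of $P$ with $x_0=x$ and $x_k=y$, $\operatorname{Lip}(\mu_{x_0x_1}\circ\cdots\circ\mu_{x_{k-1}x_k})\le g\big(\sum_{j=1}^k d_P(x_j,x_{j-1})\big)$, where $g(\delta)=e^{L\delta}$ (this is automatic from (3)). A path in $P$ is a continuous map $\gamma:[0,1]\to P$. For $s,t\in[0,1]$, $\gamma_{st}$ is the path $\gamma_{st}(u)=\gamma(su+t(1-u))$, which goes from $\gamma(t)$ to $\gamma(s)$. For paths with $\gamma(0)=\gamma'(1)$, the reverse concatenation $\gamma.\gamma'$ is the path equal to $\gamma'(2u)$ for $u\in[0,1/2]$ and $\gamma(2u-1)$ for $u\in[1/2,1]$. Two Lipschitz paths $\gamma^0,\gamma^1$ with the same starting point $a$ and the same endpoint $b$ are Lipschitz-homotopic if there is a Lipschitz map $H:[0,1]^2\to P$ with $H(0,t)=\gamma^0(t)$, $H(1,t)=\gamma^1(t)$ for all $t$, and $H(s,0)=a$, $H(s,1)=b$ for all $s$. The Lipschitz fundamental groupoid (Lipschitz homotopy groupoid) $\mathcal{G}_P^{\mathrm{Lip}}$ is the set of Lipschitz paths $[0,1]\to P$ modulo Lipschitz homotopy, with product induced by reverse concatenation; its units are the classes of constant paths (identified with points of $P$), the source of the class of $\gamma$ is $\gamma(0)$ and its range is $\gamma(1)$. A (left) action of a groupoid $G$ with set of units $G^{(0)}$, source map $\sigma$ and range map $\rho$ on a family of sets $(E_x)_{x\in G^{(0)}}$ is a family of maps $\varphi_{\mathbf g}:E_{\sigma(\mathbf g)}\to E_{\rho(\mathbf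 g)}$, $\mathbf g\in G$, with $\varphi_x=\mathrm{Id}_{E_x}$ for every unit $x$ and $\varphi_{\mathbf g\mathbf g'}=\varphi_{\mathbf g}\circ\varphi_{\mathbf g'}$ whenever $\sigma(\mathbf g)=\rho(\mathbf g')$. The action is continuous if all maps $\varphi_{\mathbf g}$ are continuous. A subdivision of the interval between $s$ and $t$ is a finite sequence $(t_0,\ldots,t_k)$ with $t_0=s$, $t_k=t$, arranged in increasing or decreasing order according to the sign of $t-s$; its mesh is $\sup_{1\le j\le k}|t_j-t_{j-1}|$.
   Formalization: The printed C' is false (P=M_x=ℝ, L=0, ε=2, μ_xy(m)=m+(x−y)^4, γ(t)=4t: distance 256, bound about 121). The formal constant is the printed C' multiplied by Lip(γ)^{2+ε}; everything else is as stated. *)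

(* Defs.v *)
From HB Require Import structures.
From mathcomp Require Import all_boot all_order all_algebra generic_quotient.
From mathcomp Require Import all_classical all_reals all_analysis.
From mathcomp Require Import ring lra.

Set Implicit Arguments.
Unset Strict Implicit.
Unset Printing Implicit Defensive.

Import Order.TTheory GRing.Theory Num.Theory.
Import numFieldTopology.Exports numFieldNormedType.Exports.

Local Open Scope classical_set_scope.
Local Open Scope ring_scope.

(** An extended metric space is a [pseudoMetricType] whose extended distance
    [edist] (library) separates points; completeness is sequential. *)
Definition extended_metric (R : realType) (T : pseudoMetricType R) : Prop :=
  forall x y : T, edist (x, y) = 0%E -> x = y.

Definition complete_extended_metric (R : realType) (T : pseudoMetricType R)
    : Prop :=
  extended_metric T /\
  forall u : nat -> T, cauchy (u @ \oo) -> exists l : T, u @ \oo --> l.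

(** [Lip D h] is the Lipschitz constant of the restriction of [h] to [D].
    In [\bar R] one has [+oo / +oo = 0], so that pairs of points at infinite
    distance impose no constraint; the [maxe 0] makes the supremum over an
    empty set of pairs equal to 0 instead of -oo. *)
Definition Lip (R : realType) (X Y : pseudoMetricType R) (D : set X)
    (h : X -> Y) : \bar R :=
  maxe 0%E (ereal_sup [set (edist (h p.1, h p.2) / edist p)%E
                    | p in [set p : X * X | [/\ D p.1, D p.2 & p.1 <> p.2]]]).

(** The extended distance on the set of continuous maps. *)
Definition dist_sup (R : realType) (X Y : pseudoMetricType R) (h h' : X -> Y)
    : \bar R :=
  maxe 0%E (ereal_sup [set edist (h m, h' m) | m in [set: X]]).

(** The Riemann zeta function at real arguments greater than 1; [riemannR z n]
    is [1 / (n + 1) ^ z]. *)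
Definition zeta (R : realType) (z : R) : R := limn (series (riemannR z)).

Definition unit_interval (R : realType) : set R := `[0, 1]%classic.
Definition unit_square (R : realType) : set (R * R) :=
  @unit_interval R `*` @unit_interval R.

Section Compositions.
Context (R : realType) (P : metricType R) (M : P -> pseudoMetricType R).
Variable mu : forall x y : P, M y -> M x.

(** [chain x [:: x_1; ...; x_(k-1)] y] is
    [mu x x_1 \o mu x_1 x_2 \o ... \o mu x_(k-1) y]. *)
Fixpoint chain (x : P) (s : seq P) (y : P) : M y -> M x :=
  if s is z :: s' then @mu x z \o @chain z s' y else @mu x y.

(** The sum of the distances between consecutive points of [x :: rcons s y]. *)
Definition chain_length (x : P) (s : seq P) (y : P) : R :=
  \sum_(d <- pairmap mdist x (rcons s y)) d.

Record strongly_approximate_action (L eps : R) (n : nat) (a b C : 'I_n -> R)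
    : Prop := {
  saa_L_ge0 : 0 <= L;
  saa_eps_gt0 : 0 < eps;
  saa_n_gt0 : (0 < n)%N;
  saa_a_gt0 : forall i, 0 < a i;
  saa_b_gt0 : forall i, 0 < b i;
  saa_ab : forall i, a i + b i = 2 + eps;
  saa_continuous : forall x y, continuous (@mu x y);
  saa_id : forall x, @mu x x = id;
  saa_Lip : forall x y, (Lip setT (@mu x y) <= (1 + L * mdist x y)%:E)%E;
  saa_approx : forall x u v y,
    (dist_sup (@mu x u \o @mu u y) (@mu x v \o @mu v y) <=
     ((1 + L * mdist u x) *
        (\sum_(i < n) C i * mdist y v `^ a i * mdist u v `^ b i) +
      \sum_(i < n) C i * mdist x u `^ b i * mdist u v `^ a i)%:E)%E;
  saa_chain_Lip : forall x y s,
    (Lip setT (@chain x s y) <= (expR (L * chain_length x s y))%:E)%E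
}.

End Compositions.

Arguments chain {R P M} mu x s y _.

(** A subdivision [(s, t_1, ..., t_(k-1), t)] is given by its interior points
    [ts = [:: t_1; ...; t_(k-1)]]. *)
Definition subdivision (R : realType) (s : R) (ts : seq R) (t : R) : bool :=
  path <=%R s (rcons ts t) || path >=%R s (rcons ts t).

Definition mesh (R : realType) (s : R) (ts : seq R) (t : R) : R :=
  \big[Num.max/0]_(d <- pairmap (fun u v => `|v - u|) s (rcons ts t)) d.

Section LipschitzCriterion.
Context (R : realType).

Lemma edist_normE (X : normedModType R) (x y : X) :
  edist (x, y) = `|x - y|%:E.
Proof.
apply/eqP; rewrite eq_le; apply/andP; split.
  apply/lee_addgt0Pr => e e0; rewrite -EFinD; apply: edist_fin => /=.
    by rewrite ltr_wpDl.
  by rewrite -ball_normE /ball_ /= ltrDl.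
apply: le_ereal_inf_tmp => _ [r /= [r0]] + <-.
by rewrite -ball_normE /ball_ /= lee_fin => /ltW.
Qed.

Lemma edist_mdistE (P : metricType R) (x y : P) : edist (x, y) = (mdist x y)%:E.
Proof.
apply/eqP; rewrite eq_le; apply/andP; split.
  apply/lee_addgt0Pr => e e0; rewrite -EFinD; apply: edist_fin => /=.
    by rewrite ltr_wpDl// mdist_ge0.
  by rewrite ballEmdist /= ltrDl.
apply: le_ereal_inf_tmp => _ [r /= [r0]] + <-.
by rewrite ballEmdist /= lee_fin => /ltW.
Qed.

Lemma Lip_finP (X : normedModType R) (P : metricType R) (D : set X)
    (f : X -> P) :
  (Lip D f < +oo)%E <->
  exists2 k : R, 0 <= k &
    forall x y, D x -> D y -> mdist (f x) (f y) <= k * `|x - y|.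
Proof.
split=> [Lf|[k k0 fk]].
  have L0 : (0 <= Lip D f)%E by rewrite /Lip le_max lexx.
  have Lfin : Lip D f \is a fin_num by rewrite ge0_fin_numE.
  exists (fine (Lip D f)); first exact: fine_ge0.
  move=> x y Dx Dy; have [->|/eqP xy] := eqVneq x y.
    by rewrite mdistxx mulr_ge0// fine_ge0.
  have xy0 : 0 < `|x - y| by rewrite normr_gt0 subr_eq0; apply/eqP.
  rewrite -ler_pdivrMr// -lee_fin fineK// /Lip le_max; apply/orP; right.
  apply: ereal_sup_ubound; exists (x, y) => //=.
  by rewrite edist_normE edist_mdistE inver (gt_eqF xy0) EFinM.
apply: (@le_lt_trans _ _ k%:E); last by rewrite ltry.
rewrite /Lip ge_max lee_fin k0 /=; apply: ge_ereal_sup.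
move=> _ [[x y] /= [Dx Dy /eqP xy] <-].
have xy0 : 0 < `|x - y| by rewrite normr_gt0 subr_eq0.
rewrite edist_normE edist_mdistE inver (gt_eqF xy0) -EFinM lee_fin.
by rewrite ler_pdivrMr// fk.
Qed.

End LipschitzCriterion.

(** Lipschitz paths [[0, 1] -> P] are represented by functions on [R], of which
    only the restriction to [[0, 1]] matters: functions that agree there are
    Lipschitz-homotopic. *)
Definition lipschitz_path (R : realType) (P : metricType R) (gamma : R -> P)
    : Prop :=
  (Lip (@unit_interval R) gamma < +oo)%E.

(** A Lipschitz path with source [y] and range [x]. *)
Record lpath (R : realType) (P : metricType R) (x y : P) := LPath {
  lpath_fun :> R -> P;
  lpath_lipschitz : lipschitz_path lpath_fun;
  lpath_source : lpath_fun 0 = y;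
  lpath_range : lpath_fun 1 = x
}.

HB.instance Definition _ (R : realType) (P : metricType R) (x y : P) :=
  gen_eqMixin (lpath x y).
HB.instance Definition _ (R : realType) (P : metricType R) (x y : P) :=
  gen_choiceMixin (lpath x y).

Definition lipschitz_homotopic (R : realType) (P : metricType R) (x y : P)
    (gamma0 gamma1 : lpath x y) : Prop :=
  exists H : R * R -> P,
    [/\ (Lip (@unit_square R) H < +oo)%E,
        forall t, unit_interval t -> H (0, t) = gamma0 t,
        forall t, unit_interval t -> H (1, t) = gamma1 t,
        forall s, unit_interval s -> H (s, 0) = y &
        forall s, unit_interval s -> H (s, 1) = x].

Section LipschitzPaths.
Context (R : realType) (P : metricType R).
Local Notation I := (@unit_interval R).
Local Notation I2 := (@unit_square R).

Lemma unit_intervalE (t : R) : I t = (0 <= t <= 1).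
Proof. by rewrite /unit_interval /= in_itv. Qed.

Lemma unit_intervalP (t : R) : I t <-> 0 <= t <= 1.
Proof. by rewrite unit_intervalE. Qed.

Lemma Lip_glue (X : normedModType R) (D A B : set X) (f g h : X -> P) :
  (forall x, D x -> A x \/ B x) ->
  (forall x y, D x -> D y -> A x -> B y -> exists z,
     [/\ D z, A z, B z, `|x - z| <= `|x - y| & `|z - y| <= `|x - y|]) ->
  (forall x, D x -> A x -> h x = f x) -> (forall x, D x -> B x -> h x = g x) ->
  (Lip (D `&` A) f < +oo)%E -> (Lip (D `&` B) g < +oo)%E -> (Lip D h < +oo)%E.
Proof.
move=> DAB sep hf hg /Lip_finP[k k0 fk] /Lip_finP[l l0 gl].
apply/Lip_finP; exists (k + l); first exact: addr_ge0.
have mix x y : D x -> D y -> A x -> B y ->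
    mdist (h x) (h y) <= (k + l) * `|x - y|.
  move=> Dx Dy Ax By; have [z [Dz Az Bz xz zy]] := sep x y Dx Dy Ax By.
  apply: le_trans (metric_triangle _ (h z) _) _; rewrite mulrDl lerD//.
    by rewrite !hf// (le_trans (fk _ _ _ _))// ler_wpM2l.
  by rewrite !hg// (le_trans (gl _ _ _ _))// ler_wpM2l.
move=> x y Dx Dy.
case: (DAB _ Dx) => [Ax|Bx]; case: (DAB _ Dy) => [Ay|By].
- by rewrite !hf// (le_trans (fk _ _ _ _))// ler_wpM2r// lerDl.
- exact: mix.
- by rewrite metric_sym distrC; exact: mix.
- by rewrite !hg// (le_trans (gl _ _ _ _))// ler_wpM2r// lerDr.
Qed.

Lemma Lip_comp (X Y : normedModType R) (D : set X) (E : set Y) (al : X -> Y)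
    (f : Y -> P) (k : R) :
  0 <= k -> (forall x, D x -> E (al x)) ->
  (forall x y, `|al x - al y| <= k * `|x - y|) ->
  (Lip E f < +oo)%E -> (Lip D (f \o al) < +oo)%E.
Proof.
move=> k0 DE alk /Lip_finP[l l0 fl]; apply/Lip_finP; exists (l * k).
  exact: mulr_ge0.
move=> x y Dx Dy /=; rewrite (le_trans (fl _ _ _ _)); [by []|exact: DE..|].
by rewrite -mulrA ler_wpM2l.
Qed.

Lemma lipschitz_const (x : P) : lipschitz_path (fun _ : R => x).
Proof. by apply/Lip_finP; exists 0 => // s t _ _; rewrite mdistxx mul0r. Qed.

Definition lpath_const (x : P) : lpath x x :=
  LPath (lipschitz_const x) erefl erefl.

(** The reverse concatenation [gamma.gamma'] first follows [gamma']. *)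
Definition concat (gamma gamma' : R -> P) (u : R) : P :=
  if u <= 2^-1 then gamma' (2 * u) else gamma (2 * u - 1).

Lemma lipschitz_concat (gamma gamma' : R -> P) :
  lipschitz_path gamma -> lipschitz_path gamma' -> gamma 0 = gamma' 1 ->
  lipschitz_path (concat gamma gamma').
Proof.
move=> L L' e.
apply: (@Lip_glue R^o I [set u | u <= 2^-1] [set u | 2^-1 <= u]
  (gamma' \o (fun u => 2 * u)) (gamma \o (fun u => 2 * u - 1))).
- by move=> x _ /=; apply/orP; exact: le_total.
- move=> x y _ _ /= x2 y2; exists 2^-1; rewrite /= unit_intervalE.
  split; [lra|lra|lra| |].
  + by rewrite ler0_norm ?ler0_norm; lra.
  + by rewrite ler0_norm ?ler0_norm; lra.
- by move=> x _ /= x2; rewrite /concat x2.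
- move=> x _ /= x2; rewrite /concat; case: ifPn => // x2'.
  have -> : x = 2^-1 by apply/le_anti; rewrite x2 x2'.
  by rewrite mulfV// subrr e.
- apply: (@Lip_comp R^o R^o _ I _ _ 2) L' => //.
  + by move=> x /= [/unit_intervalP + ?]; rewrite unit_intervalE; lra.
  + by move=> x y; rewrite -mulrBr normrM gtr0_norm.
- apply: (@Lip_comp R^o R^o _ I _ _ 2) L => //.
  + by move=> x /= [/unit_intervalP + ?]; rewrite unit_intervalE; lra.
  + move=> x y; rewrite (_ : _ - _ = 2 * (x - y)); last by ring.
    by rewrite normrM gtr0_norm.
Qed.

Lemma lpath_concat_lipschitz (x y z : P) (gamma : lpath x y)
    (gamma' : lpath y z) : lipschitz_path (concat gamma gamma').
Proof.
apply: lipschitz_concat; [exact: lpath_lipschitz..|].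
by rewrite lpath_source lpath_range.
Qed.

Lemma lpath_concat_source (x y z : P) (gamma : lpath x y)
    (gamma' : lpath y z) : concat gamma gamma' 0 = z.
Proof. by rewrite /concat invr_ge0 ler0n mulr0 lpath_source. Qed.

Lemma lpath_concat_range (x y z : P) (gamma : lpath x y)
    (gamma' : lpath y z) : concat gamma gamma' 1 = x.
Proof.
rewrite /concat ifF; last by apply/negbTE; rewrite -ltNge; lra.
by rewrite (_ : 2 * 1 - 1 = 1) ?lpath_range//; ring.
Qed.

Definition lpath_concat (x y z : P) (gamma : lpath x y) (gamma' : lpath y z)
    : lpath x z :=
  LPath (lpath_concat_lipschitz gamma gamma') (lpath_concat_source gamma gamma')
    (lpath_concat_range gamma gamma').

Lemma lipschitz_subpath (gamma : R -> P) (s t : R) :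
  lipschitz_path gamma -> I s -> I t ->
  lipschitz_path (fun u => gamma (s * u + t * (1 - u))).
Proof.
move=> L Is It.
apply: (@Lip_comp R^o R^o _ I (fun u => s * u + t * (1 - u)) _ `|s - t|) L => //.
  move: Is It => /unit_intervalP /andP[s0 s1] /unit_intervalP /andP[t0 t1].
  by move=> x /unit_intervalP /andP[x0 x1]; apply/unit_intervalP; nra.
by move=> x y; rewrite -normrM le_eqVlt; apply/orP; left; apply/eqP;
   congr `|_|; ring.
Qed.

Lemma subpath_source (gamma : R -> P) (s t : R) :
  gamma (s * 0 + t * (1 - 0)) = gamma t.
Proof. by rewrite mulr0 add0r subr0 mulr1. Qed.

Lemma subpath_range (gamma : R -> P) (s t : R) :
  gamma (s * 1 + t * (1 - 1)) = gamma s.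
Proof. by rewrite subrr mulr0 addr0 mulr1. Qed.

(** The path [gamma_st], with source [gamma t] and range [gamma s]. *)
Definition subpath (gamma : R -> P) (s t : R) (hgamma : lipschitz_path gamma)
    (hs : I s) (ht : I t) : lpath (gamma s) (gamma t) :=
  LPath (lipschitz_subpath hgamma hs ht) (subpath_source gamma s t)
    (subpath_range gamma s t).

End LipschitzPaths.

Section LipschitzGroupoid.
Context (R : realType) (P : metricType R).
Local Notation I := (@unit_interval R).
Local Notation I2 := (@unit_square R).
Local Notation A1 := [set p : R * R | p.1 <= 2^-1].
Local Notation B1 := [set p : R * R | 2^-1 <= p.1].
Local Notation A2 := [set p : R * R | p.2 <= 2^-1].
Local Notation B2 := [set p : R * R | 2^-1 <= p.2].

Lemma lipschitz_homotopic_refl (x y : P) (g : lpath x y) :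
  lipschitz_homotopic g g.
Proof.
exists (g \o snd); split => //=.
- apply: (@Lip_comp R P (R^o * R^o)%type R^o _ I _ _ 1) (lpath_lipschitz g) => //.
    by move=> [s t] [].
  by move=> [s t] [s' t']; rewrite mul1r prod_normE /= le_max lexx orbT.
- by move=> s _; rewrite lpath_source.
- by move=> s _; rewrite lpath_range.
Qed.

Lemma lipschitz_homotopic_sym (x y : P) (g h : lpath x y) :
  lipschitz_homotopic g h -> lipschitz_homotopic h g.
Proof.
move=> [H [LH H0 H1 Hy Hx]].
have Ic s : I s -> I (1 - s) by rewrite !unit_intervalE; lra.
exists (H \o (fun p => (1 - p.1, p.2))); split => /=.
- apply: (@Lip_comp R P (R^o * R^o)%type (R^o * R^o)%type _ I2 _ _ 1) LH => //.
    by move=> [s t] [/= Is It]; split => //=; exact: Ic.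
  move=> [s t] [s' t']; rewrite mul1r !prod_normE /=.
  by rewrite (_ : 1 - s - (1 - s') = - (s - s')) ?normrN//; ring.
- by move=> t It; rewrite subr0 H1.
- by move=> t It; rewrite subrr H0.
- by move=> s /Ic; exact: Hy.
- by move=> s /Ic; exact: Hx.
Qed.

Let le_nmaxl (a b c d : R) : `|a| <= `|c| -> `|b| <= `|d| ->
  Num.max `|a| `|b| <= Num.max `|c| `|d|.
Proof. by move=> ac bd; rewrite ge_max !le_max ac bd orbT. Qed.

Let le_nmax2 (a b c d : R) : `|a| <= 2 * `|c| -> `|b| <= 2 * `|d| ->
  Num.max `|a| `|b| <= 2 * Num.max `|c| `|d|.
Proof.
move=> ac bd; rewrite ge_max; apply/andP; split.
  by rewrite (le_trans ac)// ler_wpM2l// le_max lexx.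
by rewrite (le_trans bd)// ler_wpM2l// le_max lexx orbT.
Qed.

Let norm2 (a : R) : `|a| <= 2 * `|a|.
Proof. by rewrite mulr_natl mulr2n lerDl. Qed.

Lemma lipschitz_homotopic_trans (x y : P) (g h k : lpath x y) :
  lipschitz_homotopic g h -> lipschitz_homotopic h k -> lipschitz_homotopic g k.
Proof.
move=> [H [LH H0 H1 Hy Hx]] [K [LK K0 K1 Ky Kx]].
exists (fun p => if p.1 <= 2^-1 then H (2 * p.1, p.2)
                 else K (2 * p.1 - 1, p.2)); split => /=.
- apply: (@Lip_glue R P (R^o * R^o)%type I2 A1 B1
    (H \o (fun p => (2 * p.1, p.2))) (K \o (fun p : R * R => (2 * p.1 - 1, p.2)))).
  + by move=> p _ /=; apply/orP; exact: le_total.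
  + move=> [s t] [s' t'] [/= Is It] [/= Is' It'] s2 s'2; exists (2^-1, t).
    split; rewrite //= ?prod_normE /=.
    * by split => //=; rewrite unit_intervalE; lra.
    * apply: le_nmaxl; last by rewrite subrr normr0.
      by rewrite !ler0_norm; lra.
    * by apply: le_nmaxl => //; rewrite !ler0_norm; lra.
  + by move=> [s t] _ /= ->.
  + move=> [s t] [/= Is It] s2; case: ifPn => // s2'.
    have -> : s = 2^-1 by apply/le_anti; rewrite s2 s2'.
    by rewrite mulfV// subrr H1// K0.
  + apply: (@Lip_comp R P (R^o * R^o)%type (R^o * R^o)%type _ I2
      (fun p => (2 * p.1, p.2)) _ 2) LH => //.
      move=> [s t] [[/= + It] s2]; rewrite unit_intervalE => Is; split => //=.
      by rewrite unit_intervalE; lra.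
    move=> [s t] [s' t']; rewrite !prod_normE /=; apply: le_nmax2; last exact: norm2.
    by rewrite -mulrBr normrM gtr0_norm.
  + apply: (@Lip_comp R P (R^o * R^o)%type (R^o * R^o)%type _ I2
      (fun p : R * R => (2 * p.1 - 1, p.2)) _ 2) LK => //.
      move=> [s t] [[/= + It] s2]; rewrite unit_intervalE => Is; split => //=.
      by rewrite unit_intervalE; lra.
    move=> [s t] [s' t']; rewrite !prod_normE /=; apply: le_nmax2; last exact: norm2.
    rewrite (_ : _ - _ = 2 * (s - s')); last by ring.
    by rewrite normrM gtr0_norm.
- by move=> t It; rewrite invr_ge0 ler0n mulr0 H0.
- move=> t It; rewrite ifF; last by apply/negbTE; rewrite -ltNge; lra.
  by rewrite (_ : 2 * 1 - 1 = 1) ?K1//; ring.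
- move=> s; rewrite unit_intervalE => Is.
  by case: ifPn => s2; [apply: Hy|apply: Ky]; rewrite unit_intervalE; lra.
- move=> s; rewrite unit_intervalE => Is.
  by case: ifPn => s2; [apply: Hx|apply: Kx]; rewrite unit_intervalE; lra.
Qed.

Lemma lipschitz_homotopic_concat (x y z : P) (g h : lpath x y)
    (g' h' : lpath y z) :
  lipschitz_homotopic g h -> lipschitz_homotopic g' h' ->
  lipschitz_homotopic (lpath_concat g g') (lpath_concat h h').
Proof.
move=> [H [LH H0 H1 Hy Hx]] [K [LK K0 K1 Kz Ky]].
exists (fun p => if p.2 <= 2^-1 then K (p.1, 2 * p.2)
                 else H (p.1, 2 * p.2 - 1)); split => /=.
- apply: (@Lip_glue R P (R^o * R^o)%type I2 A2 B2
    (K \o (fun p => (p.1, 2 * p.2))) (H \o (fun p : R * R => (p.1, 2 * p.2 - 1)))).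
  + by move=> p _ /=; apply/orP; exact: le_total.
  + move=> [s t] [s' t'] [/= Is It] [/= Is' It'] t2 t'2; exists (s, 2^-1).
    split; rewrite //= ?prod_normE /=.
    * by split => //=; rewrite unit_intervalE; lra.
    * apply: le_nmaxl; first by rewrite subrr normr0.
      by rewrite !ler0_norm; lra.
    * by apply: le_nmaxl => //; rewrite !ler0_norm; lra.
  + by move=> [s t] _ /= ->.
  + move=> [s t] [/= Is It] t2; case: ifPn => // t2'.
    have -> : t = 2^-1 by apply/le_anti; rewrite t2 t2'.
    by rewrite mulfV// subrr Ky// Hy.
  + apply: (@Lip_comp R P (R^o * R^o)%type (R^o * R^o)%type _ I2
      (fun p => (p.1, 2 * p.2)) _ 2) LK => //.
      move=> [s t] [[/= Is +] t2]; rewrite unit_intervalE => It; split => //=.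
      by rewrite unit_intervalE; lra.
    move=> [s t] [s' t']; rewrite !prod_normE /=; apply: le_nmax2; first exact: norm2.
    by rewrite -mulrBr normrM gtr0_norm.
  + apply: (@Lip_comp R P (R^o * R^o)%type (R^o * R^o)%type _ I2
      (fun p : R * R => (p.1, 2 * p.2 - 1)) _ 2) LH => //.
      move=> [s t] [[/= Is +] t2]; rewrite unit_intervalE => It; split => //=.
      by rewrite unit_intervalE; lra.
    move=> [s t] [s' t']; rewrite !prod_normE /=; apply: le_nmax2; first exact: norm2.
    rewrite (_ : _ - _ = 2 * (t - t')); last by ring.
    by rewrite normrM gtr0_norm.
- move=> t; rewrite unit_intervalE /concat => It.
  by case: ifPn => t2; [apply: K0|apply: H0]; rewrite unit_intervalE; lra.
- move=> t; rewrite unit_intervalE /concat => It.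
  by case: ifPn => t2; [apply: K1|apply: H1]; rewrite unit_intervalE; lra.
- by move=> s Is; rewrite invr_ge0 ler0n mulr0 Kz.
- move=> s Is; rewrite ifF; last by apply/negbTE; rewrite -ltNge; lra.
  by rewrite (_ : 2 * 1 - 1 = 1) ?Hx//; ring.
Qed.

Definition homotopicb (x y : P) (g h : lpath x y) : bool :=
  `[< lipschitz_homotopic g h >].

Lemma homotopicb_refl (x y : P) : reflexive (@homotopicb x y).
Proof. by move=> g; apply/asboolP; exact: lipschitz_homotopic_refl. Qed.

Lemma homotopicb_sym (x y : P) : symmetric (@homotopicb x y).
Proof. by move=> g h; apply/asboolP/asboolP; exact: lipschitz_homotopic_sym. Qed.

Lemma homotopicb_trans (x y : P) : transitive (@homotopicb x y).
Proof.
move=> h g k /asboolP gh /asboolP hk; apply/asboolP.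
exact: lipschitz_homotopic_trans gh hk.
Qed.

Canonical homotopic_equiv (x y : P) :=
  EquivRel (@homotopicb x y) (@homotopicb_refl x y) (@homotopicb_sym x y)
    (@homotopicb_trans x y).

(** [lip_groupoid x y] is the set of elements of the Lipschitz fundamental
    groupoid with range [x] and source [y]. *)
Local Open Scope quotient_scope.

Definition lip_groupoid (x y : P) : Type := {eq_quot @homotopic_equiv x y}.
HB.instance Definition _ (x y : P) :=
  EqQuotient.copy (lip_groupoid x y) {eq_quot @homotopic_equiv x y}.

Definition lip_class (x y : P) (g : lpath x y) : lip_groupoid x y :=
  \pi_(lip_groupoid x y) g.

Definition lip_unit (x : P) : lip_groupoid x x := lip_class (lpath_const x).

Definition lip_mul (x y z : P) (g : lip_groupoid x y) (g' : lip_groupoid y z)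
    : lip_groupoid x z :=
  lip_class (lpath_concat (repr g) (repr g')).

Lemma lip_classP (x y : P) (g h : lpath x y) :
  lip_class g = lip_class h <-> lipschitz_homotopic g h.
Proof.
by split => [/eqmodP/asboolP//|gh]; apply/eqmodP/asboolP.
Qed.

Lemma lip_mulE (x y z : P) (g : lpath x y) (g' : lpath y z) :
  lip_mul (lip_class g) (lip_class g') = lip_class (lpath_concat g g').
Proof.
by apply/lip_classP/lipschitz_homotopic_concat;
   apply/lip_classP; rewrite /lip_class reprK.
Qed.

End LipschitzGroupoid.

Record continuous_action (R : realType) (P : metricType R)
    (M : P -> pseudoMetricType R)
    (phi : forall x y : P, lip_groupoid x y -> M y -> M x) : Prop := {
  action_unit : forall x, phi x x (lip_unit x) = id;
  action_mul : forall x y z (g : lip_groupoid x y) (g' : lip_groupoid y z),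
    phi x z (lip_mul g g') = phi x y g \o phi y z g';
  action_continuous : forall x y (g : lip_groupoid x y), continuous (phi x y g)
}.

(** The constant depends on the path, but not on [s] and [t]. *)
Definition approximated_by (R : realType) (P : metricType R)
    (M : P -> pseudoMetricType R) (mu : forall x y : P, M y -> M x) (eps : R)
    (phi : forall x y : P, lip_groupoid x y -> M y -> M x) : Prop :=
  forall (gamma : R -> P) (hgamma : lipschitz_path gamma),
  exists C' : R, forall (s t : R) (hs : unit_interval s) (ht : unit_interval t),
    (dist_sup (phi _ _ (lip_class (subpath hgamma hs ht)))
       (mu (gamma s) (gamma t)) <= (C' * `|t - s| `^ (1 + eps))%:E)%E.

(* Main.v *)
Require Import Defs.
From HB Require Import structures.
From mathcomp Require Import all_boot all_order all_algebra.
From mathcomp Require Import all_classical all_reals all_analysis.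
From mathcomp Require Import ring lra.

Set Implicit Arguments.
Unset Strict Implicit.
Unset Printing Implicit Defensive.

Import Order.TTheory GRing.Theory Num.Theory.
Import numFieldTopology.Exports numFieldNormedType.Exports.

Local Open Scope classical_set_scope.
Local Open Scope ring_scope.

(** Fix a Lipschitz path. Along it the maps [mu] are almost multiplicative: the
    failure of [mu_su \o mu_ut = mu_st] is at most a constant times
    [`|t - s| `^ (2 + eps)], and an exponent greater than 1 is all that the
    nonlinear sewing lemma [sewing] needs. Its heart is the maximal inequality
    [rchain_close]: a composition along any subdivision of [s, t], however fine,
    stays within a multiple of [`|t - s| `^ (2 + eps)] of [mu_st]. Applied to
    the pieces of a subdivision, it shows that refining changes a composition
    by at most the sum of the [`|t_j - t_(j-1)| `^ (2 + eps)], which is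
    [O(mesh `^ (1 + eps))]. Two subdivisions are compared through a common
    refinement ([rchain_cauchy]), so the compositions converge uniformly, to
    maps that are multiplicative in the parameters.

    The constant asked for involves [\sum_i C i] and not [\sum_i `|C i|]. When
    the [C i] have different signs, the bound on the defect at [x], [u], [y] is
    controlled by their sum only if [u] is nearly equidistant from [x] and
    [y], or so close to both that the defect is negligible. Such a point [u]
    always exists on the path, by the intermediate value theorem, and can be
    chosen so that both halves keep a fixed proportion of the parameter
    interval ([balanced_cut]). Cutting there improves any constant
    that exceeds half of the sum ([close_with_sum]). Half of the sum is at most
    the constant asked for because [zeta (2 + eps) >= 1] ([zeta_ge1]).

    The transport along a path is determined by uniform subdivisions
    ([is_transport]). It is invariant under Lipschitz homotopy
    ([is_transport_homotopic]): in an [N] by [N] grid, the image of one row is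
    moved to the next by flipping squares one at a time, and [N ^ 2] flips at a
    cost of order [N `^ - (2 + eps)] each tend to nothing; this is where the
    exponent has to exceed 2. A uniform subdivision with an even number of
    pieces of a concatenation is the concatenation of two uniform
    subdivisions, which gives the composition law ([is_transport_concat]).

    Finally a homotopy class splits as the product of its subpaths along any
    subdivision ([lip_class_subpath]), so an action close to [mu] on short
    subpaths is within [O(mesh `^ eps)] of the compositions of the [mu]; it must
    be their limit ([action_is_transport]). *)

(** * Uniform distance and Lipschitz bounds *)

Section UniformDistance.
Context (R : realType).

Definition uclose (X : Type) (Y : pseudoMetricType R) (f g : X -> Y) (D : R)
    : Prop :=
  forall m, (edist (f m, g m) <= D%:E)%E.

Definition lip_bound (X Y : pseudoMetricType R) (f : X -> Y) (K : R) : Prop :=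
  forall m m', (edist (f m, f m') <= K%:E * edist (m, m'))%E.

Section Uclose.
Context (X : Type) (Y : pseudoMetricType R).
Implicit Types (f g : X -> Y) (D E : R).

Lemma uclose_refl f D : 0 <= D -> uclose f f D.
Proof. by move=> D0 m; rewrite edist_refl lee_fin. Qed.

Lemma uclose_sym f g D : uclose f g D -> uclose g f D.
Proof. by move=> fg m; rewrite edist_sym. Qed.

Lemma uclose_trans g f (h : X -> Y) D E :
  uclose f g D -> uclose g h E -> uclose f h (D + E).
Proof.
move=> fg gh m; apply: le_trans (edist_triangle _ (g m) _) _.
by rewrite EFinD leeD.
Qed.

Lemma ucloseW f g D E : D <= E -> uclose f g D -> uclose f g E.
Proof. by move=> DE fg m; apply: le_trans (fg m) _; rewrite lee_fin. Qed.

Lemma uclose_eq f g : extended_metric Y -> uclose f g 0 -> f = g.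
Proof.
by move=> mY fg; apply/funext => m; apply: mY; apply/le_anti;
   rewrite fg edist_ge0.
Qed.

Lemma uclose_le f g D : (forall e, 0 < e -> uclose f g (D + e)) -> uclose f g D.
Proof. by move=> fg m; apply/lee_addgt0Pr => e e0; rewrite -EFinD; exact: fg. Qed.

Lemma uclose_comp (Z : Type) (h : Z -> X) f g D :
  uclose f g D -> uclose (f \o h) (g \o h) D.
Proof. by move=> fg m; exact: fg. Qed.

End Uclose.

Lemma uclose_lip (X : Type) (Y Z : pseudoMetricType R) (f g : X -> Y)
    (h : Y -> Z) (K D : R) :
  0 <= K -> lip_bound h K -> uclose f g D -> uclose (h \o f) (h \o g) (K * D).
Proof.
move=> K0 hK fg m; apply: le_trans (hK _ _) _.
by rewrite EFinM lee_wpmul2l// lee_fin.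
Qed.

Lemma dist_supP (X Y : pseudoMetricType R) (f g : X -> Y) (D : R) :
  0 <= D -> (dist_sup f g <= D%:E)%E <-> uclose f g D.
Proof.
move=> D0; split => [fgD m|fg].
  apply: le_trans fgD; rewrite /dist_sup le_max; apply/orP; right.
  by apply: ereal_sup_ubound; exists m.
rewrite /dist_sup ge_max lee_fin D0 /=; apply: ge_ereal_sup => _ [m _ <-].
exact: fg.
Qed.

Lemma uclose_dist_sup (X Y : pseudoMetricType R) (f g : X -> Y) (D : R) :
  (dist_sup f g <= D%:E)%E -> uclose f g D.
Proof.
move=> fgD; apply/dist_supP => //; rewrite -lee_fin (le_trans _ fgD)//.
by rewrite /dist_sup le_max lexx.
Qed.

Lemma dist_sup_ge0 (X Y : pseudoMetricType R) (f g : X -> Y) :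
  (0 <= dist_sup f g)%E.
Proof. by rewrite /dist_sup le_max lexx. Qed.

Lemma lip_boundP (X Y : pseudoMetricType R) (f : X -> Y) (K : R) :
  extended_metric X -> 0 < K -> (Lip setT f <= K%:E)%E <-> lip_bound f K.
Proof.
move=> mX K0; split => [fK m m'|fK].
  have [->|/eqP mm'] := eqVneq m m'.
    by rewrite edist_refl mule_ge0// ?lee_fin ?ltW// edist_ge0.
  have : (edist (f m, f m') / edist (m, m') <= K%:E)%E.
    apply: le_trans fK; rewrite /Lip le_max; apply/orP; right.
    by apply: ereal_sup_ubound; exists (m, m').
  have := edist_ge0 (m, m'); case E : (edist (m, m')) => [d| |]//.
    rewrite lee_fin le_eqVlt => /predU1P[d0|d0].
      by exfalso; apply: mm'; apply: mX; rewrite E -d0.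
    by rewrite inver gt_eqF// lee_pdivrMr.
  by move=> _ _; rewrite gt0_muley ?lte_fin// leey.
rewrite /Lip ge_max lee_fin (ltW K0)/=; apply: ge_ereal_sup => _ [[m m']] /= [_ _ mm'] <-.
have := edist_ge0 (m, m'); have := fK m m'.
case E : (edist (m, m')) => [d| |]//.
  move=> fd; rewrite lee_fin => d_ge0; have [d0|d0] := eqVneq d 0.
    by exfalso; apply: mm'; apply: mX; rewrite E d0.
  have {}d0 : 0 < d by rewrite lt_def d0.
  by rewrite inver gt_eqF// lee_pdivrMr.
by move=> _ _; rewrite invey mule0 lee_fin ltW.
Qed.

Lemma lip_boundW (X Y : pseudoMetricType R) (f : X -> Y) (K K' : R) :
  K <= K' -> lip_bound f K -> lip_bound f K'.
Proof.
move=> KK' fK m m'; apply: le_trans (fK m m') _.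
by rewrite lee_wpmul2r ?edist_ge0// lee_fin.
Qed.

Lemma lip_bound_comp (X Y Z : pseudoMetricType R) (f : Y -> Z) (g : X -> Y)
    (K K' : R) :
  0 <= K -> lip_bound f K -> lip_bound g K' -> lip_bound (f \o g) (K * K').
Proof.
move=> K0 fK gK m m'; apply: le_trans (fK _ _) _.
by rewrite EFinM -muleA lee_wpmul2l ?lee_fin.
Qed.

Lemma lip_bound_continuous (X Y : pseudoMetricType R) (f : X -> Y) (K : R) :
  0 < K -> lip_bound f K -> continuous f.
Proof.
move=> K0 fK m; apply/cvg_ballP => e e0.
have : nbhs m (ball m (e / 2 / K)).
  by apply: nbhsx_ballx; rewrite !divr_gt0.
apply: filterS => m' mm'; apply: (@edist_lt_ball _ _ _ (f m, f m')).
apply: le_lt_trans (fK _ _) _.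
apply: (@le_lt_trans _ _ (e / 2)%:E); last first.
  by rewrite lte_fin ltr_pdivrMr// ltr_pMr// ltr1n.
have -> : e / 2 = K * (e / 2 / K) by rewrite [RHS]mulrC divfK// gt_eqF.
rewrite EFinM lee_wpmul2l ?lee_fin ?(ltW K0)//.
by apply: edist_fin => //; rewrite !divr_gt0.
Qed.

Lemma lip_bound_lim (X Y : pseudoMetricType R) (f : X -> Y) (K : R) :
  (forall e, 0 < e -> exists2 g, uclose f g e & lip_bound g K) ->
  lip_bound f K.
Proof.
move=> fg m m'; apply/lee_addgt0Pr => e e0.
have [g fge gK] := fg (e / 2) (divr_gt0 e0 (ltr0n _ 2)).
have -> : e%:E = ((e / 2)%:E + (e / 2)%:E)%E by rewrite -EFinD -splitr.
apply: le_trans (edist_triangle _ (g m) _) _.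
rewrite [leRHS]addeC -addeA leeD//.
apply: le_trans (edist_triangle _ (g m') _) _.
by rewrite addeC leeD//; exact: (uclose_sym fge).
Qed.

(** The modulus of the sequence is a bound for the distance to the limit, so
    that explicit estimates survive the passage to the limit. *)
Lemma uclose_complete (X : Type) (Y : pseudoMetricType R) (f : nat -> X -> Y)
    (e : nat -> R) :
  complete_extended_metric Y -> e @ \oo --> 0 ->
  (forall i j, uclose (f i) (f j) (e i + e j)) ->
  exists l : X -> Y, forall i, uclose l (f i) (e i).
Proof.
move=> [_ cY] e0 fe.
have small d : 0 < d -> \forall i \near \oo, e i < d.
  by move=> d0; move/cvgr_lt : e0; exact.
have lim m : exists l : Y, (fun i => f i m) @ \oo --> l.
  apply: cY; apply/cauchy_ballP => d d0.
  have [N _ Ne] := small (d / 2) (divr_gt0 d0 (ltr0n _ 2)).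
  pose T := [set f i m | i in [set i | (N <= i)%N]].
  exists (T, T); first by split; exists N => // i Ni; exists i.
  move=> [_ _] /= [[i Ni <-] [j Nj <-]]; apply: (@edist_lt_ball _ _ _ (f i m, f j m)).
  apply: le_lt_trans (fe i j m) _.
  by rewrite lte_fin [ltRHS]splitr ltrD//; exact: Ne.
have [l fl] := choice lim.
exists l => i; apply: uclose_le => d d0 m.
have d20 : 0 < d / 2 by rewrite divr_gt0.
have [N _ Ne] := small _ d20.
have /cvg_ballP/(_ _ d20) [N' _ Nl] := fl m.
pose j := maxn N N'.
apply: le_trans (edist_triangle _ (f j m) _) _.
have -> : (e i + d)%:E = ((d / 2)%:E + (d / 2 + e i)%:E)%E.
  by rewrite -EFinD addrA -splitr addrC.
apply: leeD; first by apply: edist_fin => //; exact: Nl (leq_maxr _ _).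
apply: le_trans (fe j i m) _.
by rewrite lee_fin lerD2r ltW//; exact: Ne (leq_maxl _ _).
Qed.

End UniformDistance.

(** * Partitions of an interval *)

Section Partitions.
Context (R : realType).
Implicit Types (s t u v d : R) (ts : seq R).

(** Order and mesh are checked together, so that a single [path] hypothesis
    carries everything known about a subdivision through an induction. *)
Definition step d : rel R := fun u v => (u <= v) && (v - u <= d).

Lemma step_path_le d s ts : path (step d) s ts -> path <=%R s ts.
Proof. by apply: sub_path => u v /andP[]. Qed.

Lemma le_path_mem s ts t r : path <=%R s (rcons ts t) -> r \in ts -> s <= r <= t.
Proof.
move=> + rts; have := rts; move/splitPr: rts => [ts1 ts2] rts.
rewrite rcons_cat cat_path rcons_cons /= => /and3P[p1 p2 p3].
have le_last s' l : path <=%R s' l -> s' <= last s' l.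
  move=> /(order_path_min le_trans)/allP h.
  by have := mem_last s' l; rewrite inE => /predU1P[->//|/h].
apply/andP; split; first exact: le_trans (le_last _ _ p1) p2.
by have := le_last _ _ p3; rewrite last_rcons.
Qed.

Lemma le_path_ends s ts t : path <=%R s (rcons ts t) -> s <= t.
Proof.
move=> /(order_path_min le_trans)/allP; apply.
by rewrite mem_rcons mem_head.
Qed.

Lemma step_path_ge0 d s ts t : path (step d) s (rcons ts t) -> 0 <= d.
Proof.
by case: ts => [|r ts] /= /andP[/andP[] + + _]; rewrite -subr_ge0; exact: le_trans.
Qed.

Definition unif s t n : seq R :=
  [seq s + (t - s) * (i%:R / n.+1%:R) | i <- iota 1 n].

Lemma path_map_iota (T : Type) (e : rel T) (f : nat -> T) (m n : nat) :
  (forall i, (m <= i < m + n)%N -> e (f i) (f i.+1)) ->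
  path e (f m) [seq f i | i <- iota m.+1 n].
Proof.
elim: n m => [|n IH] m fe //=; rewrite fe; last first.
  by rewrite leqnn addnS ltnS leq_addr.
by apply: IH => i /andP[mi im]; apply: fe; rewrite (ltnW mi) -addSnnS.
Qed.

Lemma unif_path s t n : s <= t ->
  path (step ((t - s) / n.+1%:R)) s (rcons (unif s t n) t).
Proof.
move=> st; pose f i := s + (t - s) * (i%:R / n.+1%:R).
have -> : rcons (unif s t n) t = [seq f i | i <- iota 1 n.+1].
  rewrite -[n.+1]addn1 iotaD map_cat cats1 /=; congr (rcons _ _).
  by rewrite /f add1n divff ?mulr1 ?pnatr_eq0// addrC subrK.
have fS i : f i.+1 - f i = (t - s) / n.+1%:R.
  by rewrite /f -natr1; field; rewrite nat1r pnatr_eq0.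
rewrite -[X in path _ X](_ : f 0 = s); last by rewrite /f mul0r mulr0 addr0.
apply: path_map_iota => i _; rewrite /step fS lexx andbT.
by rewrite -subr_ge0 fS divr_ge0// subr_ge0.
Qed.

Lemma unif_path_inv s t n : s <= t -> t - s <= 1 ->
  path (step n.+1%:R^-1) s (rcons (unif s t n) t).
Proof.
move=> st ts1; have := unif_path n st; apply: sub_path => u v /andP[uv vu].
by rewrite /step uv (le_trans vu)// ler_pdivrMr// mulVf// pnatr_eq0.
Qed.

Lemma le_path_split m s ts : path <=%R s ts ->
  exists ts1 ts2, [/\ ts = ts1 ++ ts2, all (fun r => r <= m) ts1 &
                      all (fun r => m < r) ts2].
Proof.
elim: ts s => [|r ts IH] s /=; first by exists [::], [::].
move=> /andP[sr rts]; have [rm|mr] := leP r m.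
  have [ts1 [ts2 [-> h1 h2]]] := IH _ rts.
  by exists (r :: ts1), ts2; split => //=; rewrite rm.
exists [::], (r :: ts); split=> //=; rewrite mr /=.
apply: sub_all (order_path_min le_trans rts) => z; exact: lt_le_trans.
Qed.

(** For a fixed [G], the compositions along [inner G u v] depend on [u] and [v]
    in a way that is exactly multiplicative at the points of [G]. *)
Definition inner (G : seq R) u v := [seq x <- G | u < x < v].

Lemma inner_path G u v : sorted <%R G -> u <= v ->
  path <=%R u (rcons (inner G u v) v).
Proof.
move=> sG uv; rewrite (path_sortedE le_trans); apply/andP; split.
  rewrite all_rcons uv /=; apply/allP => x.
  by rewrite mem_filter => /andP[/andP[/ltW]].
rewrite (sorted_pairwise le_trans) pairwise_rcons; apply/andP; split.
  by apply/allP => x; rewrite mem_filter => /andP[/andP[_ /ltW]].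
rewrite -(sorted_pairwise le_trans); apply: (@sub_sorted _ <%R) => [x y /ltW//|].
exact: (sorted_filter lt_trans).
Qed.

Lemma inner_split G u r v : sorted <%R G -> r \in G -> u < r -> r < v ->
  inner G u v = inner G u r ++ r :: inner G r v.
Proof.
move=> sG rG ur rv; apply: (irr_sorted_eq lt_trans ltxx).
- exact: (sorted_filter lt_trans).
- rewrite (sorted_pairwise lt_trans) pairwise_cat /=; apply/and4P; split.
  + apply/allrelP => x y; rewrite mem_filter => /andP[/andP[_ xr] _].
    by rewrite inE mem_filter => /predU1P[->//|/andP[/andP[+ _] _]]; exact: lt_trans.
  + rewrite -(sorted_pairwise lt_trans); exact: (sorted_filter lt_trans).
  + by apply/allP => x; rewrite mem_filter => /andP[/andP[]].
  + rewrite -(sorted_pairwise lt_trans); exact: (sorted_filter lt_trans).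
move=> x; rewrite mem_cat inE !mem_filter.
have [->|xr] := eqVneq x r; first by rewrite ur rv rG orbT.
case: (x \in G); rewrite ?andbF//= !andbT; apply/idP/idP.
  move=> /andP[-> ->]; rewrite andbT /=.
  by move: xr; rewrite neq_lt.
by move=> /orP[/andP[-> /lt_trans->]|/andP[/(lt_trans ur)->]].
Qed.

Lemma inner0 G u : inner G u u = [::].
Proof.
rewrite /inner (@eq_filter _ _ pred0) ?filter_pred0// => x /=.
by apply/negP => /andP[ux /(lt_trans ux)]; rewrite ltxx.
Qed.

End Partitions.

Section PowerLimits.
Context (R : realType).

Lemma powR_harmonic_cvg0 (q : R) : 0 < q ->
  (fun n => n.+1%:R^-1 `^ q) @ \oo --> 0.
Proof.
move=> q0; apply/cvgrPdist_lt => e e0.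
have : 0 < e `^ q^-1 by exact: powR_gt0.
move=> /(cvgr0_norm_lt _ (@cvg_harmonic R)); apply: filterS => n /=.
rewrite sub0r normrN ger0_norm ?powR_ge0// ger0_norm ?invr_ge0// => h.
have -> : e = e `^ q^-1 `^ q by rewrite -powRrM mulVf ?gt_eqF// powRr1// ltW.
by apply: gt0_ltr_powR; rewrite // nnegrE ?powR_ge0 ?invr_ge0.
Qed.

Lemma uclose_cvg0 (X : Type) (Y : pseudoMetricType R) (f g : X -> Y)
    (D A : R) (e : nat -> R) :
  e @ \oo --> 0 -> (forall n, uclose f g (D + A * e n)) -> uclose f g D.
Proof.
move=> e0 fg; apply: uclose_le => d d0.
have : (fun n => A * e n) @ \oo --> A * 0 by apply: cvgM => //; exact: cvg_cst.
rewrite mulr0 => /cvgr_le/(_ _ d0)[N _ /(_ N (leqnn _))/= Nd].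
by apply: ucloseW (fg N); rewrite lerD2l.
Qed.

End PowerLimits.

(** * Sewing almost multiplicative families *)

Section Sewing.
Context (R : realType) (X : R -> pseudoMetricType R).
Variable T : forall u v : R, X v -> X u.

(** The spaces are indexed by parameters: a path may pass several times
    through the same point of the base, but its parameters are ordered. *)
Fixpoint rchain u ts v : X v -> X u :=
  if ts is r :: ts' then @T u r \o @rchain r ts' v else @T u v.

Arguments rchain u ts v _ : clear implicits.

Variables (La K p : R).
Let E d := expR (La * d).

Hypothesis X_complete : forall u, complete_extended_metric (X u).
Hypotheses (La0 : 0 <= La) (K0 : 0 <= K) (p1 : 1 < p).
Hypothesis T_id : forall u, 0 <= u -> u <= 1 -> @T u u = id.
Hypothesis T_lip : forall u v, 0 <= u -> u <= v -> v <= 1 ->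
  lip_bound (@T u v) (E (v - u)).
Hypothesis T_almost_mul : forall u r v, 0 <= u -> u <= r -> r <= v -> v <= 1 ->
  uclose (@T u r \o @T r v) (@T u v) (K * (v - u) `^ p).

Let E0 d : 0 <= E d. Proof. exact: expR_ge0. Qed.
Let ED u r v : E (v - u) = E (r - u) * E (v - r).
Proof. by rewrite -expRD -mulrDr; congr (expR (_ * _)); ring. Qed.
Let E_le c d : c <= d -> E c <= E d.
Proof. by move=> cd; rewrite ler_expR ler_wpM2l. Qed.
Let E_ge1 d : 0 <= d -> 1 <= E d.
Proof. by move=> d0; rewrite -expR0 ler_expR mulr_ge0. Qed.
Let p0 : 0 <= p. Proof. by rewrite ltW// (lt_trans ltr01). Qed.

Lemma rchain_cat u ts1 r ts2 v :
  rchain u (ts1 ++ r :: ts2) v = rchain u ts1 r \o rchain r ts2 v.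
Proof. by elim: ts1 u => [|z ts1 IH] u //=; rewrite IH. Qed.

Lemma rchain_rcons u ts r v : rchain u (rcons ts r) v = rchain u ts r \o @T r v.
Proof. by rewrite -cats1 rchain_cat. Qed.

Lemma rchain_lip u ts v : 0 <= u -> v <= 1 -> path <=%R u (rcons ts v) ->
  lip_bound (rchain u ts v) (E (v - u)).
Proof.
elim: ts u => [|r ts IH] u u0 v1 /=; first by rewrite andbT => uv; exact: T_lip.
move=> /andP[ur rv]; rewrite (ED u r).
have rv' := le_path_ends rv.
apply: lip_bound_comp => //; first by apply: T_lip => //; exact: le_trans v1.
by apply: IH => //; exact: le_trans ur.
Qed.

Let q := (2 `^ p)^-1.
(** The solution [B] of [B = 2 * B / 2 `^ p + 2 * K]: two halves of the interval
    and two defects. *)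
Definition sewing_const := 2 * K / (1 - 2 * (2 `^ p)^-1).
Let B := sewing_const.

Let q_lt : 2 * q < 1.
Proof.
rewrite -ltr_pdivlMr ?invr_gt0 ?powR_gt0// invrK mul1r.
rewrite -[ltLHS]powRr1// -(ltr_pM2r (x := 2 `^ (-1))) ?powR_gt0//.
rewrite -!powRD ?pnatr_eq0 ?implybT// subrr powRr0 -subr_gt0.
rewrite /powR pnatr_eq0/= subr_gt0 -[ltLHS]expR0 ltr_expR.
by rewrite mulr_gt0 ?subr_gt0// ln_gt0// ltr1n.
Qed.

Lemma sewing_const_ge0 : 0 <= sewing_const.
Proof. by rewrite divr_ge0 ?mulr_ge0// subr_ge0 ltW. Qed.

Let B0 : 0 <= B. Proof. exact: sewing_const_ge0. Qed.

Let B_eq : 2 * B * q + 2 * K = B.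
Proof.
have q1 : 1 - 2 * q != 0 by rewrite subr_eq0 gt_eqF.
rewrite /B /sewing_const -/q; field; rewrite q1.
by rewrite ?(gt_eqF (powR_gt0 _ _)).
Qed.

(** Cutting at the two consecutive points around the middle leaves two
    subdivisions of intervals at most half as long; since [p > 1], halving
    costs less than it gains and the constant does not depend on the number of
    points. *)
Lemma rchain_close u ts v : 0 <= u -> v <= 1 -> path <=%R u (rcons ts v) ->
  uclose (rchain u ts v) (@T u v) (E (v - u) * (B * (v - u) `^ p)).
Proof.
have [n] := ubnP (size ts); elim: n => // n IH in u ts v *.
rewrite ltnS => szn u0 v1 uv_path.
have uv := le_path_ends uv_path.
have u1 : u <= 1 by exact: le_trans v1.
have v0 : 0 <= v by exact: le_trans uv.
set m := (u + v) / 2; set h := (v - u) / 2; set G := E (v - u).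
have G1 : 1 <= G by apply: E_ge1; rewrite subr_ge0.
have hp : h `^ p = (v - u) `^ p * q.
  rewrite /h powRM ?subr_ge0 ?invr_ge0//; congr (_ * _).
  by rewrite -[in LHS](powR_inv1 (ler0n _ 2)) powRAC powR_inv1 ?powR_ge0.
have le_h c d : 0 <= d - c -> d - c <= h -> c <= d -> u <= c -> d <= v ->
    E (d - c) * (B * (d - c) `^ p) <= G * (B * h `^ p).
  move=> dc0 dch cd uc dv; apply: ler_pM => //.
  - by rewrite mulr_ge0 ?powR_ge0.
  - by apply: E_le; lra.
  - apply: ler_wpM2l => //; apply: ge0_ler_powR; rewrite ?nnegrE//.
    exact: le_trans dch.
(* two halves and two defects, within the bound for the whole interval *)
have final : G * (B * h `^ p) + G * (B * h `^ p) + (K * (v - u) `^ p +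
    K * (v - u) `^ p) <= G * (B * (v - u) `^ p).
  rewrite hp -[in leRHS]B_eq.
  have GK : 0 <= (G - 1) * (2 * K * (v - u) `^ p).
    by rewrite !mulr_ge0 ?powR_ge0// subr_ge0.
  rewrite -subr_ge0; move: GK; congr (_ <= _).
  by move: ((v - u) `^ p) => z; ring.
have GB0 : 0 <= G * (B * h `^ p).
  by apply: mulr_ge0; [exact: E0|apply: mulr_ge0; [exact: B0|exact: powR_ge0]].
have KB0 : 0 <= K * (v - u) `^ p by rewrite mulr_ge0// powR_ge0.
have final1 : G * (B * h `^ p) + K * (v - u) `^ p <= G * (B * (v - u) `^ p).
  by apply: le_trans final; rewrite lerD// ?lerDl.
have left_part ts1 r : path <=%R u (rcons ts1 r) -> (size ts1 < n)%N ->
    r <= m -> uclose (rchain u ts1 r) (@T u r) (G * (B * h `^ p)).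
  move=> ur sz rm; have ur' := le_path_ends ur.
  have rv : r <= v by apply: le_trans rm _; rewrite /m; lra.
  apply: ucloseW (IH _ _ _ sz u0 _ ur); last exact: le_trans v1.
  by apply: le_h => //; rewrite /h; rewrite /m in rm; lra.
have right_part ts2 r : path <=%R r (rcons ts2 v) -> (size ts2 < n)%N ->
    m < r -> uclose (@T u r \o rchain r ts2 v) (@T u r \o @T r v)
      (G * (B * h `^ p)).
  move=> rv sz mr; have rv' := le_path_ends rv.
  have ur : u <= r by apply: le_trans (ltW mr); rewrite /m; lra.
  have r0 : 0 <= r by exact: le_trans ur.
  have : E (r - u) * (E (v - r) * (B * (v - r) `^ p)) <= G * (B * h `^ p).
    rewrite mulrA -ED -/G; apply: (ler_wpM2l (E0 _)); apply: (ler_wpM2l B0).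
    by apply: ge0_ler_powR; rewrite ?nnegrE// /h ?subr_ge0//; rewrite /m in mr; lra.
  move/ucloseW; apply; apply: uclose_lip => //.
    by apply: T_lip => //; exact: le_trans v1.
  by apply: IH => //; exact: le_trans rv.
(* [r1] and [r2] are the last point before the middle and the first after it;
   either may be missing *)
have [//|ts1 [ts2 [ts_eq ts1m ts2m]]] := @le_path_split _ m u ts _.
  by move: uv_path; rewrite rcons_path => /andP[].
subst ts; move: szn uv_path; rewrite size_cat rcons_cat cat_path.
case/lastP: ts1 ts1m => [|ts1 r1] /=; case: ts2 ts2m => [|r2 ts2] /=.
- move=> _ _ _ _; apply: uclose_refl.
  by apply: mulr_ge0; [exact: E0|apply: mulr_ge0; [exact: B0|exact: powR_ge0]].
- move=> /andP[mr2 _] _ sz /andP[ur2 r2v]; rewrite add0n in sz.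
  have r2v' := le_path_ends r2v.
  apply: ucloseW (uclose_trans (right_part _ _ r2v sz mr2)
    (T_almost_mul u0 ur2 r2v' v1)) => //.
- move=> _; rewrite all_rcons => /andP[r1m _]; rewrite size_rcons addn0 => sz.
  rewrite cats0 rchain_rcons andbT last_rcons => /andP[ur1 r1v].
  have ur1' := le_path_ends ur1.
  apply: ucloseW (uclose_trans (uclose_comp (@T r1 v)
    (left_part _ _ ur1 sz r1m)) (T_almost_mul u0 ur1' r1v v1)) => //.
- move=> /andP[mr2 _]; rewrite all_rcons => /andP[r1m _].
  rewrite size_rcons last_rcons => sz /and3P[ur1 r12 r2v].
  have r2v' := le_path_ends r2v; have ur1' := le_path_ends ur1.
  have sz1 : (size ts1 < n)%N by apply: leq_trans sz; rewrite leq_addr.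
  have sz2 : (size ts2 < n)%N.
    by apply: leq_trans sz; rewrite leq_addl.
  have ur2 := le_trans ur1' r12; have r1v := le_trans r12 r2v'.
  have r10 := le_trans u0 ur1'.
  rewrite rchain_cat rchain_rcons; apply: ucloseW (uclose_trans
    (uclose_comp (@T r1 r2 \o rchain r2 ts2 v) (left_part _ _ ur1 sz1 r1m))
    (uclose_trans (uclose_comp (rchain r2 ts2 v)
       (T_almost_mul u0 ur1' r12 (le_trans r2v' v1)))
      (uclose_trans (right_part _ _ r2v sz2 mr2)
        (T_almost_mul u0 ur2 r2v' v1)))).
  apply: le_trans final; rewrite -[leRHS]addrA lerD2l addrCA lerD2l lerD2r.
  by rewrite ler_wpM2l// ge0_ler_powR ?nnegrE ?subr_ge0// lerD2r.
Qed.

Let pow_step d l : 0 <= l -> l <= d -> l `^ p <= d `^ (p - 1) * l.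
Proof.
move=> l0 ld; rewrite -mulr_powRB1 ?(lt_trans ltr01)// mulrC ler_wpM2r//.
by apply: ge0_ler_powR; rewrite ?nnegrE ?subr_ge0 ?(ltW p1)// (le_trans l0).
Qed.

(** A family that is exactly multiplicative at the points of a subdivision and
    close to [T] is close to the composition along it: replacing the factors
    one at a time costs the sum of the [(t_j - t_(j-1)) `^ p]. *)
Lemma multiplicative_close_rchain (G : R -> Prop) (S : forall u v, X v -> X u)
    (A d s t : R) (ts : seq R) : 0 <= A -> 0 <= s -> t <= 1 ->
  (forall u r, s <= u -> u <= r -> r <= t -> G r ->
     @S u t = @S u r \o @S r t) ->
  (forall u v, s <= u -> u <= v -> v <= t ->
     uclose (@S u v) (@T u v) (A * E (v - u) * (v - u) `^ p)) ->
  path (step d) s (rcons ts t) -> (forall r, r \in ts -> G r) ->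
  uclose (@S s t) (rchain s ts t) (A * E (t - s) * (d `^ (p - 1) * (t - s))).
Proof.
move=> A0; elim: ts s => [|r ts IH] s s0 t1 SM ST.
  rewrite /= andbT => /andP[st std] _; apply: ucloseW (ST _ _ _ _ _) => //.
  by apply: ler_wpM2l; [exact: mulr_ge0|apply: pow_step; rewrite ?subr_ge0].
rewrite [rcons _ _]/= [path _ _ _]/= => /andP[/andP[sr srd] rt] Gts.
have rt' := le_path_ends (step_path_le rt); have r0 := le_trans s0 sr.
rewrite (SM s r)//; last by apply: Gts; rewrite mem_head.
apply: ucloseW (uclose_trans (uclose_comp (@S r t) (ST s r _ _ _))
  (uclose_lip (E0 _) (T_lip s0 sr (le_trans rt' t1)) (IH r r0 t1 _ _ rt _))) => //.
- rewrite [X in _ + X]mulrA [E (r - s) * _]mulrCA -ED.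
  rewrite [leRHS](_ : _ = A * E (t - s) * (d `^ (p - 1) * (r - s)) +
    A * E (t - s) * (d `^ (p - 1) * (t - r))); last by ring.
  rewrite lerD2r ler_pM ?powR_ge0 ?mulr_ge0//.
  + by apply: ler_wpM2l => //; apply: E_le; lra.
  + by apply: pow_step; rewrite ?subr_ge0.
- by move=> u r' ru ur' r't Gr'; apply: SM => //; exact: le_trans ru.
- by move=> u v ru uv vt; apply: ST => //; exact: le_trans ru.
- by move=> r' r'ts; apply: Gts; rewrite inE r'ts orbT.
Qed.

Let rate d s t := B * E (t - s) * (d `^ (p - 1) * (t - s)).

Let inner_mul G s t u r : sorted <%R G -> 0 <= s -> t <= 1 ->
  s <= u -> u <= r -> r <= t -> r \in G ->
  rchain u (inner G u t) t =
  rchain u (inner G u r) r \o rchain r (inner G r t) t.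
Proof.
move=> sG s0 t1 su ur rt rG.
have u0 := le_trans s0 su; have r0 := le_trans u0 ur.
have r1 := le_trans rt t1.
have [->|ur'] := eqVneq u r; first by rewrite inner0 /= T_id.
have [->|rt'] := eqVneq r t.
  by rewrite inner0 /= T_id//; exact: le_trans rt.
by rewrite (@inner_split _ _ u r)// ?rchain_cat// lt_neqAle ?ur' ?rt'.
Qed.

(** Both compositions are compared with the one along a common refinement. *)
Lemma rchain_cauchy s t ts ts' d d' : 0 <= s -> t <= 1 ->
  path (step d) s (rcons ts t) -> path (step d') s (rcons ts' t) ->
  uclose (rchain s ts t) (rchain s ts' t) (rate d s t + rate d' s t).
Proof.
move=> s0 t1 ts_path ts'_path.
pose G := sort <=%R (undup (ts ++ ts')).
have sG : sorted <%R G by rewrite lt_sorted_uniq_le sort_uniq undup_uniq sort_le_sorted.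
have close_inner l c : path (step c) s (rcons l t) -> {subset l <= ts ++ ts'} ->
    uclose (rchain s (inner G s t) t) (rchain s l t) (rate c s t).
  move=> l_path lG.
  apply: (@multiplicative_close_rchain (fun r => r \in G)
    (fun u v => rchain u (inner G u v) v)) => //.
  - by move=> u r su ur rt rG; exact: inner_mul sG s0 t1 su ur rt rG.
  - move=> u v su uv vt; rewrite -mulrA mulrCA; apply: rchain_close.
    + exact: le_trans su.
    + exact: le_trans t1.
    + exact: inner_path.
  - by move=> r /lG; rewrite mem_sort mem_undup.
apply: uclose_trans (uclose_sym _) _; apply: close_inner => //.
  by move=> r rl; rewrite mem_cat rl.
by move=> r rl; rewrite mem_cat rl orbT.
Qed.

Let e n : R := n.+1%:R^-1 `^ (p - 1).
Let e_cvg0 : e @ \oo --> 0.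
Proof. by apply: powR_harmonic_cvg0; rewrite subr_gt0. Qed.

Let rate_cvg0 s t : (fun n => rate n.+1%:R^-1 s t) @ \oo --> 0.
Proof.
rewrite -(mulr0 (B * E (t - s))) -[X in _ * X](mul0r (t - s)).
by apply: cvgM; [exact: cvg_cst|apply: cvgM; [exact: e_cvg0|exact: cvg_cst]].
Qed.

Lemma sewing_limit s t : 0 <= s -> s <= t -> t <= 1 ->
  exists f : X t -> X s, forall d ts, path (step d) s (rcons ts t) ->
    uclose f (rchain s ts t) (rate d s t).
Proof.
move=> s0 st t1.
have ts1 : t - s <= 1 by lra.
have up n := unif_path_inv n st ts1.
have [|f fP] := uclose_complete (X_complete s) (rate_cvg0 s t)
    (f := fun n => rchain s (unif s t n) t).
  by move=> i j; exact: rchain_cauchy.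
exists f => d ts ts_path; apply: (uclose_cvg0 (A := 2) (rate_cvg0 s t)) => n.
apply: ucloseW (uclose_trans (fP n) (rchain_cauchy s0 t1 (up n) ts_path)).
by lra.
Qed.

(** The limit is multiplicative because concatenated subdivisions are again
    subdivisions. *)
Theorem sewing : exists S : forall u v, X v -> X u,
  [/\ forall s t d ts, 0 <= s -> s <= t -> t <= 1 ->
        path (step d) s (rcons ts t) ->
        uclose (@S s t) (rchain s ts t)
          (B * E (t - s) * (d `^ (p - 1) * (t - s))),
      forall s r t, 0 <= s -> s <= r -> r <= t -> t <= 1 ->
        @S s t = @S s r \o @S r t &
      forall s t, 0 <= s -> s <= t -> t <= 1 ->
        lip_bound (@S s t) (E (t - s))].
Proof.
have ex s t : exists f : X t -> X s, [/\ 0 <= s, s <= t & t <= 1] ->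
    forall d ts, path (step d) s (rcons ts t) ->
      uclose f (rchain s ts t) (rate d s t).
  have [h|h] := pselect [/\ 0 <= s, s <= t & t <= 1]; last by exists (@T s t).
  by have [s0 st t1] := h; have [f fP] := sewing_limit s0 st t1; exists f.
pose S s t := projT1 (cid (ex s t)).
have SP s t d ts : 0 <= s -> s <= t -> t <= 1 -> path (step d) s (rcons ts t) ->
    uclose (S s t) (rchain s ts t) (rate d s t).
  by move=> s0 st t1; apply: (projT2 (cid (ex s t))).
have Slip s t : 0 <= s -> s <= t -> t <= 1 -> lip_bound (S s t) (E (t - s)).
  move=> s0 st t1; apply: lip_bound_lim => c c0.
  have := rate_cvg0 s t; move=> /cvgr_le/(_ _ c0)[N _ /(_ N (leqnn _))/= Nc].
  have ts1 : t - s <= 1 by lra.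
  have up := unif_path_inv N st ts1.
  exists (rchain s (unif s t N) t).
    by apply: ucloseW Nc _; exact: SP.
  by apply: rchain_lip => //; exact: step_path_le up.
exists S; split => // s r t s0 sr rt t1.
have st := le_trans sr rt; have r0 := le_trans s0 sr; have r1 := le_trans rt t1.
have ts1 : t - s <= 1 by lra.
have rs1 : r - s <= 1 by lra.
have tr1 : t - r <= 1 by lra.
apply: uclose_eq; first by case: (X_complete s).
pose A := B * E (t - s) * (t - s) + (B * E (r - s) * (r - s) + E (r - s) *
  (B * E (t - r) * (t - r))).
apply: (uclose_cvg0 (A := A) e_cvg0) => n; rewrite add0r.
have p1' := unif_path_inv n sr rs1; have p2' := unif_path_inv n rt tr1.
have p12 : path (step n.+1%:R^-1) s
    (rcons (unif s r n ++ r :: unif r t n) t).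
  rewrite rcons_cat cat_path rcons_cons /= p2' andbT.
  by move: p1'; rewrite rcons_path.
have p12_close := SP _ _ _ _ s0 st t1 p12; rewrite rchain_cat in p12_close.
apply: ucloseW (uclose_trans p12_close (uclose_sym
  (uclose_trans (uclose_comp (S r t) (SP _ _ _ _ s0 sr r1 p1'))
    (uclose_lip (E0 _) (rchain_lip s0 r1 (step_path_le p1'))
                       (SP _ _ _ _ r0 rt t1 p2'))))).
by rewrite /rate /A -/(e n) le_eqVlt; apply/orP; left; apply/eqP; ring.
Qed.

End Sewing.

Arguments rchain {R X} T u ts v _.

(** * Scalar estimates *)

Section Scalars.
Context (R : realType).

(** For [p >= 2], expand the square in
    [(l1 + l2) `^ (p - 2) * (l1 + l2) ^+ 2]; the double product is the gain. *)
Lemma powR_add_superadd (p l1 l2 : R) : 2 <= p -> 0 <= l1 -> 0 <= l2 ->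
  l1 `^ p + l2 `^ p + 2 * (Num.min l1 l2) `^ p <= (l1 + l2) `^ p.
Proof.
move=> p2 l10 l20.
have pE x : 0 <= x -> x `^ p = x `^ (p - 2) * x ^+ 2.
  move=> x0; rewrite -powR_mulrn// -powRD ?subrK//.
  by apply/implyP => /eqP h; exfalso; lra.
have p20 : 0 <= p - 2 by rewrite subr_ge0.
have mono x : 0 <= x -> x <= l1 + l2 -> x `^ (p - 2) <= (l1 + l2) `^ (p - 2).
  by move=> x0 xl; apply: ge0_ler_powR; rewrite ?nnegrE// addr_ge0.
have m0 : 0 <= Num.min l1 l2 by rewrite le_min l10.
have ml1 : Num.min l1 l2 <= l1 by rewrite ge_min lexx.
have ml2 : Num.min l1 l2 <= l2 by rewrite ge_min lexx orbT.
move: (Num.min l1 l2) m0 ml1 ml2 => m m0 ml1 ml2.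
rewrite !pE ?addr_ge0//.
have h1 : l1 `^ (p - 2) * l1 ^+ 2 <= (l1 + l2) `^ (p - 2) * l1 ^+ 2.
  by rewrite ler_wpM2r ?sqr_ge0// mono// lerDl.
have h2 : l2 `^ (p - 2) * l2 ^+ 2 <= (l1 + l2) `^ (p - 2) * l2 ^+ 2.
  by rewrite ler_wpM2r ?sqr_ge0// mono// lerDr.
have h3 : m `^ (p - 2) * m ^+ 2 <= (l1 + l2) `^ (p - 2) * (l1 * l2).
  apply: ler_pM; rewrite ?powR_ge0 ?sqr_ge0//; last by rewrite expr2 ler_pM.
  by apply: mono => //; lra.
rewrite (_ : (l1 + l2) ^+ 2 = l1 ^+ 2 + l2 ^+ 2 + 2 * (l1 * l2)); last by ring.
by rewrite !mulrDr; apply: lerD; [exact: lerD|rewrite [leRHS]mulrCA ler_pM2l].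
Qed.

(** Comparison with the telescoping series of [1 / (n * (n + 1))]. *)
Lemma is_cvg_riemannR (z : R) : 2 <= z -> cvgn (series (riemannR z)).
Proof.
move=> z2; have z0 : 0 <= z by lra.
apply: nondecreasing_is_cvgn.
  apply/nondecreasing_seqP => n; rewrite /series /= big_nat_recr//= lerDl.
  by rewrite ltW// riemannR_gt0.
exists 2 => _ [n _ <-].
suff h m : series (riemannR z) m.+1 <= 2 - m.+1%:R^-1.
  case: n => [|n]; first by rewrite /series /= big_nil.
  by apply: le_trans (h n) _; rewrite gerBl invr_ge0.
elim: m => [|m IH].
  by rewrite /series /= big_nat1 /riemannR powR1 /= !invr1; lra.
rewrite /series /= big_nat_recr//=; apply: le_trans (lerD IH (lexx _)) _.
have m0 : 0 < m.+1%:R :> R by rewrite ltr0n.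
have : riemannR z m.+1 <= (m.+2%:R * m.+1%:R)^-1.
  rewrite /riemannR lef_pV2 ?posrE ?powR_gt0 ?mulr_gt0 ?ltr0n//.
  apply: (@le_trans _ _ (m.+2%:R `^ 2)); last by apply: ler_powR; rewrite ?ler1n.
  by rewrite (powR_mulrn 2)// expr2 ler_pM2l ?ltr0n// ler_nat.
have -> : (m.+2%:R * m.+1%:R)^-1 = m.+1%:R^-1 - m.+2%:R^-1 :> R.
  rewrite -[m.+2%:R]natr1; field; apply/andP; split; rewrite gt_eqF//.
by move: (m.+1%:R^-1) (m.+2%:R^-1) (riemannR z m.+1) => x y w; lra.
Qed.

Lemma zeta_ge1 (z : R) : 2 <= z -> 1 <= zeta z.
Proof.
move=> z2; have -> : 1 = series (riemannR z) 1%N.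
  by rewrite /series /= big_nat1 /riemannR powR1 invr1.
apply: nondecreasing_cvgn_le; last exact: is_cvg_riemannR.
apply/nondecreasing_seqP => n; rewrite /series /= big_nat_recr//= lerDl.
by rewrite ltW// riemannR_gt0//; lra.
Qed.

End Scalars.

Section DefectBound.
Context (R : realType) (n : nat) (a b C : 'I_n -> R) (p : R).
Hypotheses (a0 : forall i, 0 < a i) (b0 : forall i, 0 < b i).
Hypotheses (ab : forall i, a i + b i = p) (p0 : 0 < p).

(** The bound that a strongly approximate action gives for the distance from
    [mu_xu \o mu_uy] to [mu_xy], in terms of the distances from [u] to the two
    other points. With coefficients of both signs it is not monotone. *)
Definition defect (x y : R) := \sum_(i < n) C i * x `^ b i * y `^ a i.
Let SC := \sum_(i < n) C i.
Let AC := \sum_(i < n) `|C i|.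

Let powD (x : R) i : x `^ b i * x `^ a i = x `^ p.
Proof.
rewrite -powRD; first by rewrite addrC ab.
by apply/implyP => /eqP h; move: p0; rewrite -(ab i) addrC h ltxx.
Qed.

Lemma defect_diag x : defect x x = SC * x `^ p.
Proof. by rewrite /defect /SC mulr_suml; apply: eq_bigr => i _; rewrite -mulrA powD. Qed.

Lemma defect_le x y z : 0 <= x -> 0 <= y -> x <= z -> y <= z ->
  defect x y <= AC * z `^ p.
Proof.
move=> x0 y0 xz yz; have z0 := le_trans x0 xz.
rewrite /defect /AC mulr_suml; apply: ler_sum => i _; rewrite -mulrA.
apply: (@le_trans _ _ (`|C i| * (x `^ b i * y `^ a i))).
  by rewrite ler_wpM2r ?ler_norm// mulr_ge0// powR_ge0.
rewrite ler_wpM2l// -(powD z i) ler_pM ?powR_ge0//.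
  by apply: ge0_ler_powR; rewrite ?nnegrE// ltW.
by apply: ge0_ler_powR; rewrite ?nnegrE// ltW.
Qed.

(** By homogeneity [defect x y] is [x `^ p] times a function of [y / x], which
    is continuous at 1 with the sum of the coefficients as value there. *)
Lemma defect_near_diag kappa : (0 < n)%N -> 0 < kappa ->
  exists2 theta, 0 < theta & forall x y, 0 <= x -> 0 <= y ->
    `|x - y| <= theta * x -> defect x y <= (SC + kappa) * x `^ p.
Proof.
move=> n0 kappa0.
have kn0 : 0 < kappa / n%:R by rewrite divr_gt0// ltr0n.
have : \forall z \near (1 : R), forall i, C i * z `^ a i <= C i + kappa / n%:R.
  apply: (@filter_forall _ _ (fun i z => C i * z `^ a i <= C i + kappa / n%:R)
    (nbhs (1 : R))) => i.
  have : (fun z : R => C i * z `^ a i) @ (1 : R) --> C i * 1 `^ a i.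
    apply: cvgM; first exact: cvg_cst.
    have : {for 1, continuous (fun z : R => z `^ a i)}; last by [].
    apply: differentiable_continuous; apply/derivable1_diffP.
    by apply: derivable_powR; rewrite in_itv /= ltr01.
  rewrite powR1 mulr1 => /cvgr_le; apply.
  by rewrite ltrDl.
move=> /nbhs_ballP[d /= d0 hd].
exists (d / 2) => [|x y x0 y0 xy]; first by rewrite divr_gt0.
have [x_eq0|x_neq0] := eqVneq x 0.
  move: xy; rewrite x_eq0 mulr0 sub0r normrN normr_le0 => /eqP ->.
  rewrite /defect powR0 ?gt_eqF// mulr0 big1// => i _.
  by rewrite !powR0 ?gt_eqF// mulr0.
have x_gt0 : 0 < x by rewrite lt_def x_neq0.
have bz : ball (1 : R) d (y / x).
  rewrite -ball_normE /ball_ /=.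
  have -> : 1 - y / x = (x - y) / x by rewrite mulrBl divff.
  rewrite normrM normfV (ger0_norm x0) ltr_pdivrMr//.
  by apply: le_lt_trans xy _; rewrite ltr_pM2r//; lra.
have xyE i : C i * x `^ b i * y `^ a i = C i * (y / x) `^ a i * x `^ p.
  rewrite -(powD x i) powRM ?invr_ge0//.
  rewrite -[x^-1]powR_inv1// powRAC powR_inv1 ?powR_ge0//.
  by field; rewrite gt_eqF// powR_gt0.
rewrite /defect (eq_bigr _ (fun i _ => xyE i)) -mulr_suml.
apply: ler_wpM2r; first exact: powR_ge0.
apply: (@le_trans _ _ (\sum_(i < n) (C i + kappa / n%:R))).
  by apply: ler_sum => i _; exact: hd.
rewrite big_split /= lerD2l sumr_const card_ord -(mulr_natr (kappa / _)) divfK//.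
by rewrite pnatr_eq0 -lt0n.
Qed.

End DefectBound.

(** * Transport along a Lipschitz curve *)

Section Transport.
Context (R : realType) (P : metricType R) (M : P -> pseudoMetricType R).
Variable mu : forall x y : P, M y -> M x.
Variables (L eps : R) (n : nat) (a b C : 'I_n -> R).
Hypothesis M_complete : forall x : P, complete_extended_metric (M x).
Hypothesis mu_action : strongly_approximate_action mu L eps a b C.

Let p := 2 + eps.
Let SC := \sum_(i < n) C i.
Let AC := \sum_(i < n) `|C i|.
Let dfct := defect a b C.

Let L0 : 0 <= L. Proof. exact: saa_L_ge0 mu_action. Qed.
Let eps0 : 0 < eps. Proof. exact: saa_eps_gt0 mu_action. Qed.
Let n0 : (0 < n)%N. Proof. exact: saa_n_gt0 mu_action. Qed.
Let a0 i : 0 < a i. Proof. exact: saa_a_gt0 mu_action i. Qed.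
Let b0 i : 0 < b i. Proof. exact: saa_b_gt0 mu_action i. Qed.
Let ab i : a i + b i = p. Proof. exact: saa_ab mu_action i. Qed.
Let p0 : 0 < p. Proof. by rewrite addr_gt0. Qed.
Let AC0 : 0 <= AC. Proof. exact: sumr_ge0. Qed.

Lemma mu_lip x y : lip_bound (@mu x y) (expR (L * mdist x y)).
Proof.
have d0 : 0 <= mdist x y by exact: mdist_ge0.
apply: (@lip_boundW _ _ _ _ (1 + L * mdist x y)); first exact: expR_ge1Dx.
apply/lip_boundP; last exact: saa_Lip mu_action x y.
  by case: (M_complete y).
by rewrite ltr_pwDl// mulr_ge0.
Qed.

(** The comparison of [mu_xu \o mu_uy] with [mu_xv \o mu_vy] at [v = y]. *)
Lemma mu_defect_dist x u y :
  (dist_sup (@mu x u \o @mu u y) (@mu x y) <=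
   (dfct (mdist x u) (mdist u y))%:E)%E.
Proof.
have := saa_approx mu_action x u y y; rewrite (saa_id mu_action).
rewrite mdistxx big1 ?mulr0 ?add0r//.
by move=> i _; rewrite powR0 ?mulr0 ?mul0r// gt_eqF.
Qed.

Lemma mu_defect x u y : uclose (@mu x u \o @mu u y) (@mu x y)
  (dfct (mdist x u) (mdist u y)).
Proof. exact/uclose_dist_sup/mu_defect_dist. Qed.

(** Going from [x] to [y] and back has the nonnegative defect bound
    [SC * mdist x y `^ p]. *)
Lemma sum_coef_ge0 (x y : P) : x <> y -> 0 <= SC.
Proof.
move=> /eqP xy; have d0 : 0 < mdist x y by rewrite mdist_gt0.
have := le_trans (dist_sup_ge0 _ _) (mu_defect_dist x y x).
rewrite lee_fin metric_sym /dfct (defect_diag C ab p0) pmulr_lge0//.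
by rewrite powR_gt0// metric_sym.
Qed.

Lemma mu_square x u v y delta : 0 <= delta ->
  mdist x u <= delta -> mdist u v <= delta -> mdist y v <= delta ->
  uclose (@mu x u \o @mu u y) (@mu x v \o @mu v y)
    ((2 + L * delta) * (AC * delta `^ p)).
Proof.
move=> delta0 xu uv yv.
apply: ucloseW (uclose_dist_sup (saa_approx mu_action x u v y)).
have d0 (z z' : P) : 0 <= mdist z z' by exact: mdist_ge0.
have h1 : \sum_(i < n) C i * mdist y v `^ a i * mdist u v `^ b i <=
    AC * delta `^ p.
  rewrite -[leLHS]/(defect b a C (mdist y v) (mdist u v)).
  by apply: defect_le => // i; rewrite addrC.
have h2 : \sum_(i < n) C i * mdist x u `^ b i * mdist u v `^ a i <=
    AC * delta `^ p.
  by rewrite -[leLHS]/(dfct (mdist x u) (mdist u v)); apply: defect_le.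
have A0 : 0 <= AC * delta `^ p by rewrite mulr_ge0// powR_ge0.
have Lux : L * mdist u x <= L * delta by rewrite ler_wpM2l// metric_sym.
rewrite (_ : 2 + L * delta = (1 + L * delta) + 1); last by ring.
rewrite [leRHS]mulrDl mul1r lerD//.
apply: (@le_trans _ _ ((1 + L * mdist u x) * (AC * delta `^ p))).
  by rewrite ler_wpM2l// addr_ge0// mulr_ge0.
by rewrite ler_wpM2r// lerD2l.
Qed.

Section Curve.
Variables (w : R -> P) (k : R).
Hypothesis k0 : 0 <= k.
Hypothesis wk : forall u v, unit_interval u -> unit_interval v ->
  mdist (w u) (w v) <= k * `|u - v|.

Let wk_le u v : 0 <= u -> u <= v -> v <= 1 -> mdist (w u) (w v) <= k * (v - u).
Proof.
move=> u0 uv v1; apply: le_trans (wk _ _) _.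
- by rewrite unit_intervalE u0 (le_trans uv).
- by rewrite unit_intervalE v1 (le_trans u0).
by rewrite distrC ger0_norm// subr_ge0.
Qed.

(** Intermediate value theorem for the difference of the two distances. *)
Lemma metric_bisector s t : 0 <= s -> s <= t -> t <= 1 ->
  exists2 r, s <= r <= t & mdist (w s) (w r) = mdist (w r) (w t).
Proof.
move=> s0 st t1; pose f r := mdist (w s) (w r) - mdist (w r) (w t).
have f_cont : {within `[s, t], continuous f}.
  apply/subspace_continuousP => x /=; rewrite in_itv /= => xst.
  apply/cvgrPdist_le => e e0.
  have d0 : 0 < e / (2 * k + 1) by rewrite divr_gt0// ltr_wpDl// mulr_ge0.
  apply/nbhs_ballP; exists (e / (2 * k + 1)) => //= y.
  rewrite -ball_normE /ball_ /= in_itv /= => xy yst.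
  have xyk : mdist (w x) (w y) <= k * `|x - y|.
    by apply: wk; rewrite unit_intervalE; lra.
  have fxy : `|f x - f y| <= 2 * mdist (w x) (w y).
    have h1 := metric_triangle (w s) (w x) (w y).
    have h2 := metric_triangle (w s) (w y) (w x).
    have h3 := metric_triangle (w x) (w y) (w t).
    have h4 := metric_triangle (w y) (w x) (w t).
    rewrite (metric_sym (w y) (w x)) in h2 h4.
    by rewrite /f ler_norml; apply/andP; split; lra.
  apply: le_trans fxy _.
  move: xy; rewrite ltr_pdivlMr => [xy|]; last by rewrite ltr_wpDl// mulr_ge0.
  have := normr_ge0 (x - y); nra.
have [|r] := IVT (v := 0) st f_cont; last first.
- by rewrite in_itv /= => rst /eqP; rewrite /f subr_eq0 => /eqP; exists r.
have D0 : 0 <= mdist (w s) (w t) by exact: mdist_ge0.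
by rewrite /f !mdistxx sub0r subr0 ge_min le_max; lra.
Qed.

(** If the two halves of the curve have nearly equal chords, or if all chords
    are short, the middle will do; otherwise the endpoints are far apart and a
    metric bisector cuts off a definite proportion of the interval. *)
Lemma balanced_cut kappa : 0 < k -> 0 <= SC -> 0 < kappa ->
  exists c, [/\ 0 < c, c <= 2^-1 & forall s t, 0 <= s -> s <= t -> t <= 1 ->
    exists r, [/\ s <= r, r <= t, c * (t - s) <= Num.min (r - s) (t - r) &
      dfct (mdist (w s) (w r)) (mdist (w r) (w t)) <=
        (SC + kappa) * (k * Num.min (r - s) (t - r)) `^ p]].
Proof.
move=> k_gt0 SC0 kappa0.
have [theta theta0 thetaP] := defect_near_diag C a0 b0 ab p0 n0 kappa0.
have AC1 : 0 < AC + 1 by rewrite ltr_wpDl.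
(* chords up to [rho * (k * (t - s))] have a defect of at most
   [kappa * (k * (t - s) / 2) `^ p] *)
pose rho := (kappa / (AC + 1)) `^ p^-1 / 2.
have rho0 : 0 < rho by rewrite divr_gt0// powR_gt0// divr_gt0.
pose c := rho / (2 * (1 + theta^-1)).
have th0 : 0 < theta^-1 by rewrite invr_gt0.
have c0 : 0 < c by rewrite divr_gt0// mulr_gt0// addr_gt0.
exists (Num.min c 2^-1); rewrite lt_min c0 invr_gt0 ltr0n ge_min lexx orbT.
split => // s t s0 st t1.
have ts0 : 0 <= t - s by rewrite subr_ge0.
have d_ge0 (z z' : P) : 0 <= mdist z z' by exact: mdist_ge0.
pose m := (s + t) / 2.
have ms : m - s = (t - s) / 2 by rewrite /m; field.
have mt : t - m = (t - s) / 2 by rewrite /m; field.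
have sm : s <= m by rewrite -subr_ge0 ms divr_ge0.
have mt' : m <= t by rewrite -subr_ge0 mt divr_ge0.
pose x := mdist (w s) (w m); pose y := mdist (w m) (w t).
have middle : dfct x y <= (SC + kappa) * (k * ((t - s) / 2)) `^ p ->
    exists r, [/\ s <= r, r <= t,
      Num.min c 2^-1 * (t - s) <= Num.min (r - s) (t - r) &
      dfct (mdist (w s) (w r)) (mdist (w r) (w t)) <=
        (SC + kappa) * (k * Num.min (r - s) (t - r)) `^ p].
  move=> xy; exists m; split => //; rewrite ms mt minxx//.
  by rewrite mulrC ler_wpM2l// ge_min lexx orbT.
have xk : x <= k * ((t - s) / 2) by rewrite -ms wk_le// (le_trans mt').
have yk : y <= k * ((t - s) / 2) by rewrite -mt wk_le// (le_trans s0).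
have [xy|xy] := leP `|x - y| (theta * x).
  apply: middle; apply: le_trans (thetaP _ _ (d_ge0 _ _) (d_ge0 _ _) xy) _.
  apply: ler_wpM2l; first by rewrite addr_ge0// ltW.
  by apply: ge0_ler_powR; rewrite ?nnegrE ?(ltW p0) ?d_ge0 ?mulr_ge0 ?divr_ge0.
have [z_small|z_large] := leP (Num.max x y) (rho * (k * (t - s))).
  apply: middle.
  apply: (@le_trans _ _ (AC * (rho * (k * (t - s))) `^ p)).
    by apply: defect_le; rewrite ?d_ge0//; apply: le_trans z_small;
       rewrite le_max lexx ?orbT.
  have -> : rho * (k * (t - s)) =
      (kappa / (AC + 1)) `^ p^-1 * (k * ((t - s) / 2)) by rewrite /rho; field.
  have q0 : 0 <= kappa / (AC + 1) by rewrite ltW// divr_gt0.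
  rewrite powRM ?powR_ge0 ?mulr_ge0 ?divr_ge0 ?(ltW k_gt0)//.
  rewrite -powRrM mulVf ?gt_eqF// (powRr1 q0) mulrA.
  apply: ler_wpM2r; first exact: powR_ge0.
  apply: (@le_trans _ _ kappa); last by rewrite lerDr.
  by rewrite mulrA ler_pdivrMr// mulrC; apply: ler_wpM2l; rewrite ?lerDl// ltW.
have D_large : rho * (k * (t - s)) <= (1 + theta^-1) * mdist (w s) (w t).
  have D_xy : `|x - y| <= mdist (w s) (w t).
    have h1 := metric_triangle (w s) (w t) (w m).
    have h2 := metric_triangle (w m) (w s) (w t).
    rewrite (metric_sym (w t) (w m)) in h1; rewrite (metric_sym (w m) (w s)) in h2.
    by rewrite ler_norml /x /y; apply/andP; split; lra.
  have x_xy : x <= theta^-1 * `|x - y| by rewrite mulrC ler_pdivlMr// mulrC ltW.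
  have z_le : Num.max x y <= x + `|x - y|.
    rewrite ge_max lerDl normr_ge0 /= -lerBlDl.
    by rewrite distrC ler_norm.
  apply: le_trans (ltW z_large) _; apply: le_trans z_le _.
  rewrite mulrDl mul1r addrC lerD//.
  by apply: le_trans x_xy _; rewrite ler_wpM2l// ltW.
have [r /andP[sr rt] bis] := metric_bisector s0 st t1.
have sr_k : mdist (w s) (w r) <= k * (r - s) by rewrite wk_le// (le_trans rt).
have rt_k : mdist (w s) (w r) <= k * (t - r).
  by rewrite bis wk_le// (le_trans s0).
have D_le : mdist (w s) (w t) <= 2 * mdist (w s) (w r).
  by have := metric_triangle (w s) (w r) (w t); rewrite -bis; lra.
have min_k : mdist (w s) (w r) <= k * Num.min (r - s) (t - r).
  by rewrite /Num.min; case: ifP.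
exists r; split => //; last first.
  rewrite -bis /dfct (defect_diag C ab p0).
  have SCk : SC <= SC + kappa by rewrite lerDl ltW.
  apply: ler_pM => //; rewrite ?powR_ge0//.
  by apply: ge0_ler_powR; rewrite ?nnegrE ?(ltW p0)// (le_trans _ min_k).
apply: (@le_trans _ _ (c * (t - s))); first by rewrite ler_wpM2r// ge_min lexx.
rewrite -(ler_pM2l k_gt0); apply: le_trans min_k.
have th10 : 0 < 1 + theta^-1 by rewrite addr_gt0.
have -> : k * (c * (t - s)) = rho * (k * (t - s)) / (2 * (1 + theta^-1)).
  by rewrite /c; ring.
rewrite ler_pdivrMr ?mulr_gt0//; apply: le_trans D_large _.
by rewrite mulrCA mulrA [leRHS]mulrC; apply: ler_wpM2l => //; exact: ltW.
Qed.

Let X (u : R) : pseudoMetricType R := M (w u).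
Let T (u v : R) : X v -> X u := @mu (w u) (w v).
Let K := AC * k `^ p.
Let E d := expR (L * k * d).
Let B := sewing_const K p.

Let rchainE u ts v : rchain T u ts v = chain mu (w u) (map w ts) (w v).
Proof. by elim: ts u => [|r ts IH] u //=; rewrite IH. Qed.

Let K0 : 0 <= K. Proof. by rewrite mulr_ge0// powR_ge0. Qed.
Let Lk0 : 0 <= L * k. Proof. by rewrite mulr_ge0. Qed.

Let T_lip u v : 0 <= u -> u <= v -> v <= 1 -> lip_bound (@T u v) (E (v - u)).
Proof.
move=> u0 uv v1; apply: lip_boundW (@mu_lip (w u) (w v)).
by rewrite ler_expR -mulrA ler_wpM2l// wk_le.
Qed.

Let T_almost_mul u r v : 0 <= u -> u <= r -> r <= v -> v <= 1 ->
  uclose (@T u r \o @T r v) (@T u v) (K * (v - u) `^ p).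
Proof.
move=> u0 ur rv v1; have uv := le_trans ur rv.
apply: ucloseW (@mu_defect (w u) (w r) (w v)).
rewrite /K -mulrA -powRM ?subr_ge0//; apply: defect_le => //.
- exact: mdist_ge0.
- exact: mdist_ge0.
- apply: le_trans (wk_le u0 ur (le_trans rv v1)) _.
  by rewrite ler_wpM2l// lerD2r.
- apply: le_trans (wk_le (le_trans u0 ur) rv v1) _.
  by rewrite ler_wpM2l// lerD2l lerN2.
Qed.

Section Improvement.
Variable S : forall u v : R, X v -> X u.
Hypothesis S_mul : forall s r t, 0 <= s -> s <= r -> r <= t -> t <= 1 ->
  @S s t = @S s r \o @S r t.

Let close_with beta := forall s t, 0 <= s -> s <= t -> t <= 1 ->
  uclose (@S s t) (@T s t) (E (t - s) * (beta * (t - s) `^ p)).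

(** Cutting in balanced pieces improves the constant by a fixed proportion of
    its excess over half of the defect constant [K1]. *)
Let close_improve kappa c beta :
  (forall s t, 0 <= s -> s <= t -> t <= 1 ->
    exists r, [/\ s <= r, r <= t, c * (t - s) <= Num.min (r - s) (t - r) &
      dfct (mdist (w s) (w r)) (mdist (w r) (w t)) <=
        (SC + kappa) * (k * Num.min (r - s) (t - r)) `^ p]) ->
  0 <= c -> 0 <= SC + kappa -> (SC + kappa) * k `^ p <= 2 * beta ->
  close_with beta ->
  close_with (beta - (2 * beta - (SC + kappa) * k `^ p) * c `^ p).
Proof.
set K1 := (SC + kappa) * k `^ p => cutP c0 SCk0 K1b Sb s t s0 st t1.
have K10 : 0 <= K1 by rewrite mulr_ge0// powR_ge0.
have beta0 : 0 <= beta by lra.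
have [r [sr rt]] := cutP s t s0 st t1.
have l10 : 0 <= r - s by rewrite subr_ge0.
have l20 : 0 <= t - r by rewrite subr_ge0.
have m0 : 0 <= Num.min (r - s) (t - r) by rewrite le_min l10.
have p2 : 2 <= 2 + eps by rewrite lerDl ltW.
have := powR_add_superadd p2 l10 l20.
move: (Num.min (r - s) (t - r)) m0 => m m0; rewrite -/p.
rewrite (_ : r - s + (t - r) = t - s); last by ring.
move=> superadd cm; rewrite powRM// mulrA -/K1 => dK1.
have r0 := le_trans s0 sr; have r1 := le_trans rt t1.
rewrite (S_mul s0 sr rt t1).
apply: ucloseW (uclose_trans (uclose_comp (@S r t) (Sb s r s0 sr r1))
  (uclose_trans (uclose_lip (expR_ge0 _) (T_lip s0 sr r1) (Sb r t r0 rt t1))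
    (@mu_defect (w s) (w r) (w t)))).
have E_mul : E (t - s) = E (r - s) * E (t - r).
  by rewrite -expRD -mulrDr; congr (expR (_ * _)); ring.
have E_ge1 d : 0 <= d -> 1 <= E d.
  by move=> d0; rewrite -expR0 ler_expR mulr_ge0.
have E1 : E (r - s) <= E (t - s).
  by rewrite E_mul ler_peMr ?expR_ge0// E_ge1.
have ts0 : 0 <= t - s by rewrite subr_ge0 (le_trans sr).
have E2 := E_ge1 _ ts0; have E3 := le_trans ler01 E2.
have mp : c `^ p * (t - s) `^ p <= m `^ p.
  rewrite -powRM//; apply: ge0_ler_powR; rewrite ?nnegrE ?(ltW p0)//.
  by rewrite mulr_ge0.
apply: (@le_trans _ _ (E (t - s) * (beta * (r - s) `^ p) +
  (E (t - s) * (beta * (t - r) `^ p) + E (t - s) * (K1 * m `^ p)))).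
  apply: lerD; first by rewrite ler_wpM2r// mulr_ge0// powR_ge0.
  apply: lerD; first by rewrite mulrA -E_mul.
  by apply: le_trans dK1 _; rewrite ler_peMl// mulr_ge0// powR_ge0.
rewrite -!mulrDr; apply: (ler_wpM2l E3).
rewrite [leRHS]mulrBl -[X in _ <= _ - X]mulrA.
have h1 := ler_wpM2l beta0 superadd.
have h2 : (2 * beta - K1) * (c `^ p * (t - s) `^ p) <=
    (2 * beta - K1) * m `^ p by rewrite ler_wpM2l// subr_ge0.
move: h1 h2; move: (c `^ p * _) (m `^ p) ((r - s) `^ p) ((t - r) `^ p).
by move: ((t - s) `^ p) K1 {K1b K10 dK1} => x K1 y z x1 x2; lra.
Qed.

(** Iterating the improvement, the excess of the constant over
    [(SC + kappa) * k `^ p / 2] decreases geometrically; then let [kappa] tend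
    to 0. *)
Lemma close_with_sum beta : 0 < k -> 0 <= SC -> 0 <= beta ->
  close_with beta -> close_with (SC * k `^ p / 2).
Proof.
move=> k_gt0 SC0 beta0 Sbeta s t s0 st t1.
set G := E (t - s); set Z := (t - s) `^ p.
have G0 : 0 <= G by exact: expR_ge0.
have Z0 : 0 <= Z by exact: powR_ge0.
have kp0 : 0 <= k `^ p by exact: powR_ge0.
suff h kappa : 0 < kappa ->
    uclose (@S s t) (@T s t) (G * ((SC + kappa) * k `^ p / 2 * Z)).
  apply: uclose_le => e e0.
  have A0 : 0 <= G * (k `^ p * Z) by rewrite !mulr_ge0.
  have kappa0 : 0 < e / (G * (k `^ p * Z) + 1) by rewrite divr_gt0// ltr_wpDl.
  have ke : e / (G * (k `^ p * Z) + 1) * (G * (k `^ p * Z) + 1) = e.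
    by rewrite divfK// gt_eqF// ltr_wpDl.
  apply: ucloseW (h _ kappa0); move: (e / _) kappa0 ke => kappa kappa0.
  rewrite (_ : G * ((SC + kappa) * k `^ p / 2 * Z) =
    G * (SC * k `^ p / 2 * Z) + kappa * (G * (k `^ p * Z)) / 2); last by ring.
  rewrite lerD2l; have := mulr_ge0 (ltW kappa0) A0.
  by move: (G * (k `^ p * Z)) => A kA; rewrite mulrDr mulr1 => <-; lra.
move=> kappa0.
have [c [c0 c2 cutP]] := balanced_cut k_gt0 SC0 kappa0.
set K1 := (SC + kappa) * k `^ p.
have SCk0 : 0 <= SC + kappa by rewrite addr_ge0// ltW.
have K10 : 0 <= K1 by rewrite mulr_ge0.
pose q := 1 - 2 * c `^ p.
have cp0 : 0 < c `^ p by exact: powR_gt0.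
have cp : c `^ p <= 2^-1.
  apply: (le_trans _ c2); apply: ge1r_powR; first by lra.
  by rewrite /p; have := eps0; lra.
have q0 : 0 <= q by rewrite /q; lra.
have q1 : q < 1 by rewrite /q; lra.
have iter i : close_with ((K1 + 2 * beta * q ^+ i) / 2).
  elim: i => [|i IH].
    move=> s' t' s0' st' t1'; apply: ucloseW (Sbeta s' t' s0' st' t1').
    rewrite ler_wpM2l ?expR_ge0// ler_wpM2r ?powR_ge0// expr0 mulr1.
    by lra.
  have := close_improve cutP (ltW c0) SCk0 _ IH; rewrite -/K1.
  have -> : (K1 + 2 * beta * q ^+ i) / 2 -
      (2 * ((K1 + 2 * beta * q ^+ i) / 2) - K1) * c `^ p =
      (K1 + 2 * beta * q ^+ i.+1) / 2 by rewrite exprS /q; field.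
  apply; rewrite mulrCA mulfV// mulr1 lerDl mulr_ge0 ?exprn_ge0//.
  by rewrite mulr_ge0.
have q_cvg : (fun i => q ^+ i) @ \oo --> 0.
  by apply: cvg_expr; rewrite ger0_norm.
apply: (uclose_cvg0 (A := G * (beta * Z)) q_cvg) => i.
apply: ucloseW (iter i s t s0 st t1); rewrite -/G -/Z le_eqVlt.
by apply/orP; left; apply/eqP; field.
Qed.

End Improvement.

(** The sum of the coefficients is known to be nonnegative only on a base with
    at least two points, hence the form of the hypothesis; on a constant curve
    [k = 0] and every bound vanishes. *)
Theorem curve_transport : 0 <= SC * k `^ p ->
  exists S : forall u v, M (w v) -> M (w u), exists2 A, 0 <= A &
  [/\ forall s t d ts, 0 <= s -> s <= t -> t <= 1 ->
        path (step d) s (rcons ts t) ->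
        uclose (S s t) (chain mu (w s) (map w ts) (w t)) (A * d `^ (1 + eps)),
      forall s t, 0 <= s -> s <= t -> t <= 1 ->
        uclose (S s t) (@mu (w s) (w t))
          (expR (L * k * (t - s)) * (SC * (k * (t - s)) `^ p)) &
      forall s t, 0 <= s -> s <= t -> t <= 1 ->
        lip_bound (S s t) (expR (L * k * (t - s)))].
Proof.
move=> SCk0.
have p1 : 1 < p by rewrite /p; have := eps0; lra.
have p1E : p - 1 = 1 + eps by rewrite /p; ring.
have T_id u : 0 <= u -> u <= 1 -> @T u u = id.
  by move=> _ _; exact: (saa_id mu_action).
have [S [rate S_mul S_lip]] := sewing (fun u => M_complete (w u)) Lk0 K0 p1
  T_id T_lip T_almost_mul.
rewrite -/B p1E in rate.
have B0 : 0 <= B by exact: sewing_const_ge0.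
exists S, (B * E 1); first by rewrite mulr_ge0 ?expR_ge0.
split => //.
- move=> s t d ts s0 st t1 ts_path; rewrite -rchainE.
  apply: ucloseW (rate s t d ts s0 st t1 ts_path).
  have d0 := powR_ge0 d (1 + eps).
  rewrite -[leLHS]mulrA -[leRHS]mulrA; apply: (ler_wpM2l B0); apply: ler_pM.
  + exact: expR_ge0.
  + by rewrite mulr_ge0// subr_ge0.
  + by rewrite ler_expR ler_wpM2l//; lra.
  + by rewrite ler_piMr//; lra.
- move=> s t s0 st t1.
  have close_B s' t' : 0 <= s' -> s' <= t' -> t' <= 1 ->
      uclose (S s' t') (@T s' t') (E (t' - s') * (B * (t' - s') `^ p)).
    move=> s0' st' t1'; have := rate s' t' (t' - s') [::] s0' st' t1'.
    rewrite /= /step st' lexx -p1E => /(_ isT); apply: ucloseW.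
    have l0 : 0 <= t' - s' by rewrite subr_ge0.
    rewrite -(mulr_powRB1 l0 p0) le_eqVlt; apply/orP; left; apply/eqP.
    by rewrite /E; ring.
  have [k_eq0|k_neq0] := eqVneq k 0.
    apply: ucloseW (close_B s t s0 st t1).
    have -> : B = 0.
      by rewrite /B /sewing_const /K k_eq0 powR0 ?gt_eqF// !mulr0 mul0r.
    by rewrite mul0r mulr0 k_eq0 mul0r powR0 ?gt_eqF// !mulr0.
  have k_gt0 : 0 < k by rewrite lt_def k_neq0.
  have SC0 : 0 <= SC by move: SCk0; rewrite pmulr_lge0 ?powR_gt0.
  apply: ucloseW (close_with_sum S_mul k_gt0 SC0 B0 close_B s0 st t1).
  apply: ler_wpM2l; first exact: expR_ge0.
  rewrite powRM ?subr_ge0// mulrA ler_wpM2r ?powR_ge0//; lra.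
Qed.

End Curve.
End Transport.

(** * Subdivisions in both directions *)

Section Subdivisions.
Context (R : realType).
Implicit Types (s t d : R) (ts : seq R).

Lemma path_and (T : Type) (e1 e2 : rel T) x l :
  path e1 x l -> path e2 x l -> path (fun u v => e1 u v && e2 u v) x l.
Proof.
by elim: l x => //= y l IH x /andP[-> h1] /andP[-> h2]; exact: IH.
Qed.

Lemma mesh_path d s ts t :
  mesh s ts t <= d -> path (fun u v => `|v - u| <= d) s (rcons ts t).
Proof.
rewrite /mesh; elim: (rcons ts t) s => //= r l IH s.
by rewrite big_cons ge_max => /andP[-> /IH].
Qed.

(** The direction is not recorded: it follows from the order of the ends, and
    when these coincide the subdivision is constant. *)
Definition monotone_steps d s ts t :=
  path (step d) s (rcons ts t) || path (fun u v => step d v u) s (rcons ts t).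

Lemma subdivision_monotone d s ts t :
  subdivision s ts t -> mesh s ts t <= d -> monotone_steps d s ts t.
Proof.
move=> /orP[] h /mesh_path/(path_and h) hd; apply/orP; [left|right].
  apply: sub_path hd => u v /andP[uv]; rewrite ger0_norm ?subr_ge0// => vu.
  by rewrite /step uv.
apply: sub_path hd => u v /= /andP[uv]; rewrite ler0_norm ?subr_le0// opprB => vu.
by rewrite /step uv.
Qed.

(** Decreasing subdivisions are reduced to increasing ones by the reflection
    [r |-> 1 - r] of the unit interval. *)
Lemma path_reflect (e : rel R) s l :
  path e (1 - s) [seq 1 - r | r <- l] = path (fun u v => e (1 - u) (1 - v)) s l.
Proof. by elim: l s => //= r l IH s; rewrite IH. Qed.

Lemma path_step_reflect d s ts t : path (fun u v => step d v u) s (rcons ts t) ->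
  path (step d) (1 - s) (rcons [seq 1 - r | r <- ts] (1 - t)).
Proof.
move=> h; rewrite -(map_rcons (fun r => 1 - r)) path_reflect.
by apply: sub_path h => u v; rewrite /step /= => /andP[uv vu]; lra.
Qed.

Lemma path_step_degenerate d s ts t : path (step d) s (rcons ts t) ->
  t <= s -> path (fun u v => step d v u) s (rcons ts t).
Proof.
move=> h ts_le; have d0 := step_path_ge0 h.
have st_le := le_path_ends (step_path_le h).
have : all (fun r => r == s) (rcons ts t).
  rewrite all_rcons eq_le ts_le st_le /=; apply/allP => r.
  move=> /(le_path_mem (step_path_le h))/andP[sr rt].
  by rewrite eq_le sr andbT (le_trans rt).
elim: (rcons ts t) => //= r l IH /andP[/eqP -> /IH ->].
by rewrite /step lexx subrr d0.
Qed.

Lemma path_step_reflectK d s ts t :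
  path (step d) (1 - s) (rcons [seq 1 - r | r <- ts] (1 - t)) ->
  path (fun u v => step d v u) s (rcons ts t).
Proof.
rewrite -(map_rcons (fun r => 1 - r)) path_reflect.
by apply: sub_path => u v; rewrite /step /= => /andP[uv vu]; lra.
Qed.

Lemma path_reflect_step d s ts t :
  path (fun u v => step d v u) (1 - s) (rcons [seq 1 - r | r <- ts] (1 - t)) ->
  path (step d) s (rcons ts t).
Proof.
rewrite -(map_rcons (fun r => 1 - r)) (path_reflect (fun u v => step d v u)).
by apply: sub_path => u v; rewrite /step /= => /andP[uv vu]; lra.
Qed.

Lemma monotone_steps_le d s ts t : s <= t -> monotone_steps d s ts t ->
  path (step d) s (rcons ts t).
Proof.
move=> st /orP[//|/path_step_reflect/path_step_degenerate h].
by apply: path_reflect_step; apply: h; rewrite lerD2l lerN2.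
Qed.

Lemma monotone_steps_ge d s ts t : t <= s -> monotone_steps d s ts t ->
  path (fun u v => step d v u) s (rcons ts t).
Proof. by move=> ts_le /orP[/path_step_degenerate|//]; exact. Qed.

End Subdivisions.

(** * Transport along Lipschitz paths *)

Section PathTransport.
Context (R : realType) (P : metricType R) (M : P -> pseudoMetricType R).
Variable mu : forall x y : P, M y -> M x.
Variables (L eps : R) (n : nat) (a b C : 'I_n -> R).
Hypothesis M_complete : forall x : P, complete_extended_metric (M x).
Hypothesis mu_action : strongly_approximate_action mu L eps a b C.

Let SC := \sum_(i < n) C i.
Local Notation I := (@unit_interval R).

Lemma chain_cat x l1 z l2 y :
  chain mu x (l1 ++ z :: l2) y = chain mu x l1 z \o chain mu z l2 y.
Proof. by elim: l1 x => [|r l1 IH] x //=; rewrite IH. Qed.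

Lemma fine_Lip_ge0 (gamma : R -> P) : 0 <= fine (Lip I gamma).
Proof. by rewrite fine_ge0// /Lip le_max lexx. Qed.

Lemma mdist_le_Lip (gamma : R -> P) : lipschitz_path gamma ->
  forall u v, I u -> I v ->
  mdist (gamma u) (gamma v) <= fine (Lip I gamma) * `|u - v|.
Proof.
move=> Lg u v Iu Iv; have [->|/eqP uv] := eqVneq u v.
  by rewrite mdistxx mulr_ge0// fine_Lip_ge0.
have uv0 : 0 < `|u - v| by rewrite normr_gt0 subr_eq0; apply/eqP.
rewrite -ler_pdivrMr// -lee_fin fineK; last first.
  by rewrite ge0_fin_numE// /Lip le_max lexx.
rewrite /Lip le_max; apply/orP; right.
apply: ereal_sup_ubound; exists (u, v) => //=.
by rewrite (edist_normE (X := R^o)) edist_mdistE inver (gt_eqF uv0) EFinM.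
Qed.

Lemma sum_coef_Lip_ge0 (gamma : R -> P) : lipschitz_path gamma ->
  0 <= SC * fine (Lip I gamma) `^ (2 + eps).
Proof.
move=> Lg; have p0 : 2 + eps != 0.
  by have := saa_eps_gt0 mu_action => e0; rewrite gt_eqF// addr_gt0.
have [->|k_neq0] := eqVneq (fine (Lip I gamma)) 0; first by rewrite powR0// mulr0.
have k_gt0 : 0 < fine (Lip I gamma) by rewrite lt_def k_neq0 fine_Lip_ge0.
have : (0 < Lip I gamma)%E by rewrite -lte_fin fineK in k_gt0 => //;
  rewrite ge0_fin_numE// /Lip le_max lexx.
rewrite /Lip lt_max ltxx /= => /ereal_sup_gt[_ [[u v] /= [_ _ _] <-]].
rewrite edist_mdistE.
have [->|/eqP uv _] := eqVneq (gamma u) (gamma v).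
  by rewrite mdistxx mul0e ltxx.
by rewrite mulr_ge0 ?powR_ge0//; exact: (sum_coef_ge0 mu_action uv).
Qed.

(** The endpoints [x = w s] and [y = w t] are free variables: after a change of
    parameter, [M (w s)] and [M x] would have equal but not convertible base
    points. *)
Let transport_data k (w : R -> P) x y s t (S : M y -> M x) (A : R) :=
  [/\ forall d ts, monotone_steps d s ts t ->
        uclose S (chain mu x (map w ts) y) (A * d `^ (1 + eps)),
      uclose S (@mu x y)
        (expR (L * k * `|t - s|) * (SC * (k * `|t - s|) `^ (2 + eps))) &
      lip_bound S (expR (L * k * `|t - s|))].

Let transport_increasing k (w : R -> P) s t x y : 0 <= k ->
  (forall u v, I u -> I v -> mdist (w u) (w v) <= k * `|u - v|) ->
  0 <= SC * k `^ (2 + eps) -> 0 <= s -> s <= t -> t <= 1 ->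
  w s = x -> w t = y ->
  exists S, exists2 A, 0 <= A & @transport_data k w x y s t S A.
Proof.
move=> k0 wk SCk s0 st t1 <- <-.
have [S [A A0 [rate near lip]]] := curve_transport M_complete mu_action k0 wk SCk.
exists (S s t), A => //; rewrite /transport_data ger0_norm ?subr_ge0//; split.
- by move=> d ts /(monotone_steps_le st); exact: rate.
- exact: near.
- exact: lip.
Qed.

Lemma path_transport (gamma : R -> P) s t :
  lipschitz_path gamma -> I s -> I t ->
  let k := fine (Lip I gamma) in
  exists S : M (gamma t) -> M (gamma s), exists2 A, 0 <= A &
  [/\ forall d ts, monotone_steps d s ts t ->
        uclose S (chain mu (gamma s) (map gamma ts) (gamma t))
          (A * d `^ (1 + eps)),
      uclose S (@mu (gamma s) (gamma t))
        (expR (L * k * `|t - s|) * (SC * (k * `|t - s|) `^ (2 + eps))) &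
      lip_bound S (expR (L * k * `|t - s|))].
Proof.
move=> Lg Is It k.
have k0 : 0 <= k by exact: fine_Lip_ge0.
have gk := mdist_le_Lip Lg; have SCk := sum_coef_Lip_ge0 Lg.
move: Is It; rewrite !unit_intervalE => /andP[s0 s1] /andP[t0 t1].
have [st|ts_lt] := leP s t.
  exact: (transport_increasing k0 gk SCk s0 st t1 erefl erefl).
pose w u := gamma (1 - u).
have wk u v : I u -> I v -> mdist (w u) (w v) <= k * `|u - v|.
  rewrite !unit_intervalE => u01 v01; apply: le_trans (gk _ _ _ _) _.
  - by rewrite unit_intervalE; lra.
  - by rewrite unit_intervalE; lra.
  by rewrite (_ : 1 - u - (1 - v) = - (u - v)) ?normrN//; ring.
have s0' : 0 <= 1 - s by lra.
have t1' : 1 - t <= 1 by lra.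
have st' : 1 - s <= 1 - t by lra.
have ws : w (1 - s) = gamma s by rewrite /w subKr.
have wt : w (1 - t) = gamma t by rewrite /w subKr.
have [S [A A0]] := transport_increasing k0 wk SCk s0' st' t1' ws wt.
rewrite /transport_data (_ : 1 - t - (1 - s) = - (t - s)) ?normrN; last by ring.
move=> [rate near lip]; exists S, A => //; split => // d ts.
move=> /(monotone_steps_ge (ltW ts_lt))/path_step_reflect h.
have := rate d [seq 1 - r | r <- ts]; rewrite /monotone_steps h => /(_ isT).
rewrite -map_comp (_ : map _ ts = map gamma ts)//.
by apply: eq_map => u /=; rewrite /w subKr.
Qed.

(** The interior points of a uniform subdivision in [m.+1] pieces are listed
    from the range of the path to its source, in the order of composition. *)
Definition grid (g : R -> P) m := [seq g (1 - i%:R / m.+1%:R) | i <- iota 1 m].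

(** The transport along [g] as a limit along uniform subdivisions only: this
    determines it and is easy to compare for concatenated or homotopic
    paths. *)
Definition is_transport x y (g : R -> P) (f : M y -> M x) :=
  forall e, 0 < e -> exists N, forall m, (N <= m)%N ->
    uclose f (chain mu x (grid g m) y) e.

Lemma is_transport_uniq x y g (f f' : M y -> M x) :
  is_transport g f -> is_transport g f' -> f = f'.
Proof.
move=> gf gf'; apply: uclose_eq; first by case: (M_complete x).
apply: uclose_le => e e0; rewrite add0r.
have e20 : 0 < e / 2 by rewrite divr_gt0.
have [N hN] := gf _ e20; have [N' hN'] := gf' _ e20.
rewrite [e]splitr; apply: uclose_trans (hN _ (leq_maxl N N')) _.
exact: uclose_sym (hN' _ (leq_maxr N N')).
Qed.

Lemma rate_cvg0 (A e : R) : 0 <= A -> 0 < e ->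
  exists N, forall m, (N <= m)%N -> A * m.+1%:R^-1 `^ (1 + eps) < e.
Proof.
move=> A0 e0.
have eps1 : 0 < 1 + eps by have := saa_eps_gt0 mu_action; lra.
have : (fun m => A * (m.+1%:R^-1 : R) `^ (1 + eps)) @ \oo --> A * 0.
  by apply: cvgM; [exact: cvg_cst|exact: powR_harmonic_cvg0].
rewrite mulr0 => /cvgr_lt/(_ _ e0)[N _ hN]; exists N => m Nm; exact: hN.
Qed.

Lemma subpath_grid (gamma : R -> P) s t m : I s -> I t -> exists2 ts,
  grid (fun u => gamma (s * u + t * (1 - u))) m = map gamma ts &
  monotone_steps m.+1%:R^-1 s ts t.
Proof.
rewrite !unit_intervalE => s01 t01.
exists (unif s t m).
  rewrite /grid /unif -map_comp; apply: eq_map => i /=; congr gamma.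
  by move: (_ / _) => v; ring.
apply/orP; have [st|ts_lt] := leP s t; [left|right].
  by apply: unif_path_inv => //; lra.
apply: path_step_reflectK.
have -> : [seq 1 - r | r <- unif s t m] = unif (1 - s) (1 - t) m.
  by rewrite /unif -map_comp; apply: eq_map => i /=; move: (_ / _) => v; ring.
by apply: unif_path_inv; lra.
Qed.

Lemma grid_mem (m i : nat) : (i <= m.+1)%N -> I (1 - i%:R / m.+1%:R).
Proof.
move=> im; rewrite unit_intervalE.
have : 0 <= i%:R / m.+1%:R :> R by rewrite divr_ge0.
have : i%:R / m.+1%:R <= 1 :> R by rewrite ler_pdivrMr ?ltr0n// mul1r ler_nat.
by move: (_ / _) => v; lra.
Qed.

Lemma is_transport_eq x y g g' (f : M y -> M x) :
  (forall u, I u -> g u = g' u) -> is_transport g f -> is_transport g' f.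
Proof.
move=> gg' gf e /gf[N hN]; exists N => m /hN.
rewrite (_ : grid g m = grid g' m)//; apply/eq_in_map => i.
by rewrite mem_iota => /andP[_ im]; apply: gg'; apply: grid_mem; rewrite ltnW.
Qed.

Lemma subpath_is_transport (gamma : R -> P) s t A
    (S : M (gamma t) -> M (gamma s)) : 0 <= A -> I s -> I t ->
  (forall d ts, monotone_steps d s ts t ->
     uclose S (chain mu (gamma s) (map gamma ts) (gamma t))
       (A * d `^ (1 + eps))) ->
  is_transport (fun u => gamma (s * u + t * (1 - u))) S.
Proof.
move=> A0 Is It rate e e0; have [N hN] := rate_cvg0 A0 e0.
exists N => m /hN/ltW Ae; have [ts -> ts_steps] := subpath_grid gamma m Is It.
by apply: ucloseW Ae _; exact: rate.
Qed.

Lemma lpath_transport x y (g : lpath x y) :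
  exists f : M y -> M x, is_transport g f /\ exists2 K, 0 < K & lip_bound f K.
Proof.
move: (lpath_lipschitz g) (lpath_source g) (lpath_range g).
move: (lpath_fun g) => {}g Lg <- <-.
have I1 : I 1 by rewrite unit_intervalE lexx ler01.
have I0 : I 0 by rewrite unit_intervalE lexx ler01.
have [S [A A0 [rate _ lip]]] := path_transport Lg I1 I0.
exists S; split; last by exists (expR (L * fine (Lip I g) * `|0 - 1|)); rewrite ?expR_gt0.
apply: is_transport_eq (subpath_is_transport A0 I1 I0 rate) => u _.
by rewrite mul1r mul0r addr0.
Qed.

Lemma is_transport_lip x y (g : lpath x y) (f : M y -> M x) :
  is_transport g f -> exists2 K, 0 < K & lip_bound f K.
Proof.
by move=> gf; have [f' [/(is_transport_uniq gf) <-]] := lpath_transport g.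
Qed.

(** * Units and composition *)

Lemma is_transport_const x : is_transport (fun=> x) (@id (M x)).
Proof.
move=> e e0; exists 0%N => m _.
rewrite (_ : chain mu x _ x = id); first by apply: uclose_refl; exact: ltW.
by rewrite /grid; elim: (iota 1 m) => [|i l IH] /=; rewrite (saa_id mu_action)//.
Qed.

Lemma grid_concat x y z (g : lpath x y) (g' : lpath y z) m :
  grid (concat g g') (m + m.+1) = grid g m ++ y :: grid g' m.
Proof.
have m0 : m.+1%:R != 0 :> R by rewrite pnatr_eq0.
have mE : (m + m.+1).+1%:R = 2 * m.+1%:R :> R.
  by rewrite -addSn natrD; ring.
rewrite /grid iotaD map_cat add1n; congr (_ ++ _).
  apply/eq_in_map => i; rewrite mem_iota add1n ltnS mE => /andP[i1 im].
  have im' : i%:R <= m%:R :> R by rewrite ler_nat.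
  rewrite /concat ifF; first by congr (lpath_fun g _); field.
  apply/negbTE; rewrite -ltNge invfM mulrCA.
  have : i%:R / m.+1%:R < 1 :> R by rewrite ltr_pdivrMr ?ltr0n// mul1r ltr_nat.
  by move: (_ / _) => v; lra.
rewrite /=; congr (_ :: _).
  rewrite /concat mE invfM mulrCA divff// mulr1 ifT; last by lra.
  by rewrite (_ : 2 * (1 - 2^-1) = 1) ?lpath_range//; field.
rewrite -[m.+2]addn1 iotaDl -map_comp.
apply: eq_map => i /=; rewrite mE natrD.
have iE : (m.+1%:R + i%:R) / (2 * m.+1%:R) = 2^-1 + 2^-1 * (i%:R / m.+1%:R) :> R.
  by field.
have i0 : 0 <= i%:R / m.+1%:R :> R by rewrite divr_ge0.
rewrite /concat iE ifT; first by congr (lpath_fun g' _); field.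
by move: (_ / _) i0 => v; lra.
Qed.

(** Half of the uniform subdivisions of a concatenation, those in [2 * m.+1]
    pieces, are compatible with it, and they suffice to identify the limit. *)
Lemma is_transport_concat x y z (g : lpath x y) (g' : lpath y z)
    (f : M y -> M x) (f' : M z -> M y) (h : M z -> M x) :
  is_transport g f -> is_transport g' f' -> is_transport (concat g g') h ->
  h = f \o f'.
Proof.
move=> gf gf' gh; have [K K0 fK] := is_transport_lip gf.
apply: uclose_eq; first by case: (M_complete x).
apply: uclose_le => e e0; rewrite add0r.
have e30 : 0 < e / 3 by rewrite divr_gt0.
have eK0 : 0 < e / 3 / K by rewrite divr_gt0.
have [N hN] := gf _ e30; have [N' hN'] := gf' _ eK0.
have [N'' hN''] := gh _ e30.
pose m := maxn N (maxn N' N'').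
have hm : (N'' <= m + m.+1)%N.
  by apply: leq_trans (leq_addr _ _); rewrite /m !leq_max leqnn !orbT.
have := hN'' _ hm; rewrite grid_concat chain_cat => hm1.
apply: ucloseW (uclose_trans hm1 (uclose_sym
  (uclose_trans (uclose_lip (ltW K0) fK (hN' m _))
                (uclose_comp _ (hN m _))))).
- by rewrite mulrCA divff ?gt_eqF// mulr1; lra.
- by rewrite /m !leq_max leqnn orbT.
- by rewrite /m leq_max leqnn.
Qed.

(** * Homotopy invariance *)

Let AC := \sum_(i < n) `|C i|.

(** The square with corners [f i], [f i.+1], [g i], [g i.+1] is flipped after the
    rest of the chain has been moved; the connecting map [mu (f i) (g i)]
    disappears when both chains start at the same point. *)
Let chain_slide (f g : nat -> P) (delta : R) (y : P) : 0 <= delta -> forall m i,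
  f (i + m.+1)%N = y -> g (i + m.+1)%N = y ->
  (forall j, (j <= i + m)%N -> mdist (f j) (f j.+1) <= delta) ->
  (forall j, (j <= i + m)%N -> mdist (g j) (g j.+1) <= delta) ->
  (forall j, (j <= i + m)%N -> mdist (f j.+1) (g j) <= delta) ->
  uclose (chain mu (f i) [seq f j | j <- iota i.+1 m] y)
    (@mu (f i) (g i) \o chain mu (g i) [seq g j | j <- iota i.+1 m] y)
    (m.+1%:R * expR (L * delta * m%:R) * ((2 + L * delta) * (AC * delta `^ (2 + eps)))).
Proof.
move=> delta0; have L0 := saa_L_ge0 mu_action.
set W := (2 + L * delta) * _.
have W0 : 0 <= W.
  by rewrite !mulr_ge0 ?powR_ge0 ?sumr_ge0// addr_ge0// mulr_ge0.
elim=> [|m IH] i fy gy ff gg fg.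
  rewrite mulr0 expR0 mulr1 mul1r /=; rewrite addn1 in fy gy.
  have := ff i; have := gg i; have := fg i.
  rewrite addn0 leqnn fy gy => /(_ isT) h1 /(_ isT) h2 /(_ isT) h3.
  have := @mu_square _ _ _ _ _ _ _ _ _ _ mu_action (f i) y (g i) y _ delta0 h3 h1.
  by rewrite metric_sym (saa_id mu_action); exact.
have ei : (i.+1 + m = i + m.+1)%N by rewrite addSnnS.
have {}IH := IH i.+1; rewrite addSnnS ei in IH.
have {}IH := IH fy gy ff gg fg.
have im : (i <= i + m.+1)%N by rewrite leq_addr.
rewrite [iota _ m.+1]/= [map _ (_ :: _)]/= [chain _ (f i) _ _]/=.
rewrite [map g (_ :: _)]/= [chain _ (g i) _ _]/=.
have sq := @mu_square _ _ _ _ _ _ _ _ _ _ mu_action (f i) (f i.+1) (g i)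
  (g i.+1) _ delta0 (ff i im) (fg i im) _.
rewrite metric_sym in sq.
have fl := @mu_lip _ _ _ _ _ _ _ _ _ _ M_complete mu_action (f i) (f i.+1).
apply: ucloseW (uclose_trans (uclose_lip (expR_ge0 _) fl IH)
  (uclose_comp (chain mu (g i.+1) [seq g j | j <- iota i.+2 m] y)
    (sq (gg i im)))).
rewrite -/W; apply: (@le_trans _ _ (expR (L * delta * m.+1%:R) *
   (m.+1%:R * W) + expR (L * delta * m.+1%:R) * W)); last first.
  by rewrite -mulrDr le_eqVlt; apply/orP; left; apply/eqP; rewrite -[m.+2%:R]natr1; ring.
have Ld : 0 <= L * delta by rewrite mulr_ge0.
apply: lerD; last first.
  by rewrite ler_peMl// -expR0 ler_expR mulr_ge0.
rewrite [leLHS](_ : _ = expR (L * mdist (f i) (f i.+1)) *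
  expR (L * delta * m%:R) * (m.+1%:R * W)); last by ring.
apply: ler_wpM2r; first by rewrite mulr_ge0.
rewrite -expRD ler_expR -[m.+1%:R]natr1 mulrDr mulr1 addrC lerD2l.
by rewrite ler_wpM2l// ff.
Qed.

(** On the [m.+1] by [m.+1] grid, sliding one row onto the next costs
    [O(m.+1 * m.+1%:R^-1 `^ (2 + eps))]; adding up the rows leaves
    [O(m.+1%:R^-1 `^ eps)]. *)
Lemma is_transport_homotopic x y (g0 g1 : lpath x y) (f : M y -> M x) :
  lipschitz_homotopic g0 g1 -> is_transport g0 f -> is_transport g1 f.
Proof.
move=> [H [LH H0 H1 Hy Hx]] g0f.
have L0 := saa_L_ge0 mu_action; have eps0 := saa_eps_gt0 mu_action.
have [k k0 Hk] := (Lip_finP (X := (R^o * R^o)%type) _ _).1 LH.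
pose W := (2 + L * k) * (AC * k `^ (2 + eps)).
have W0 : 0 <= W.
  by rewrite !mulr_ge0 ?powR_ge0 ?sumr_ge0// addr_ge0// mulr_ge0.
pose D := expR (L * k) * W.
have D0 : 0 <= D by rewrite mulr_ge0// expR_ge0.
suff close_rows m : uclose (chain mu x (grid g0 m) y) (chain mu x (grid g1 m) y)
    (D * m.+1%:R^-1 `^ eps).
  move=> e e0; have e20 : 0 < e / 2 by rewrite divr_gt0.
  have : (fun m => D * (m.+1%:R^-1 : R) `^ eps) @ \oo --> D * 0.
    by apply: cvgM; [exact: cvg_cst|exact: powR_harmonic_cvg0].
  rewrite mulr0 => /cvgr_le/(_ _ e20)[N _ hN]; have [N' hN'] := g0f _ e20.
  exists (maxn N N') => m; rewrite geq_max => /andP[Nm N'm].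
  rewrite [e]splitr; apply: uclose_trans (hN' m N'm) _.
  by apply: ucloseW (close_rows m); exact: hN.
have m0 : (0 : R) < m.+1%:R by rewrite ltr0n.
pose delta := k / m.+1%:R.
have delta0 : 0 <= delta by rewrite divr_ge0.
pose row j i := H (j%:R / m.+1%:R, 1 - i%:R / m.+1%:R).
have jI (j : nat) : (j <= m.+1)%N -> I (j%:R / m.+1%:R).
  by move=> /grid_mem; rewrite !unit_intervalE; move: (_ / _) => v; lra.
have rowx j : (j <= m.+1)%N -> row j 0%N = x.
  by move=> jm; rewrite /row mul0r subr0 Hx//; exact: jI.
have rowy j : (j <= m.+1)%N -> row j m.+1 = y.
  by move=> jm; rewrite /row divff ?gt_eqF// subrr Hy//; exact: jI.
have step_norm (i : nat) : `|i.+1%:R / m.+1%:R - i%:R / m.+1%:R| = m.+1%:R^-1 :> R.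
  by rewrite -mulrBl -natr1 addrC addKr mul1r ger0_norm// invr_ge0 ltW.
have row_close j j' i i' : (j <= m.+1)%N -> (j' <= m.+1)%N -> (i <= m.+1)%N ->
    (i' <= m.+1)%N -> `|j%:R / m.+1%:R - j'%:R / m.+1%:R| <= m.+1%:R^-1 :> R ->
    `|i%:R / m.+1%:R - i'%:R / m.+1%:R| <= m.+1%:R^-1 :> R ->
    mdist (row j i) (row j' i') <= delta.
  move=> jm j'm im i'm jj' ii'; apply: le_trans (Hk _ _ _ _) _.
  - by split; [exact: jI|exact: grid_mem].
  - by split; [exact: jI|exact: grid_mem].
  rewrite /delta; apply: ler_wpM2l => //; rewrite prod_normE /= ge_max jj' /=.
  by rewrite (_ : 1 - _ - (1 - _) = - (i%:R / m.+1%:R - i'%:R / m.+1%:R)) ?normrN//; ring.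
have row_step j : (j <= m)%N ->
    uclose (chain mu x [seq row j i | i <- iota 1 m] y)
      (chain mu x [seq row j.+1 i | i <- iota 1 m] y)
      (m.+1%:R * (expR (L * k) * (W * m.+1%:R^-1 `^ (2 + eps)))).
  move=> jm; have jm' := leqW jm.
  have dist0 (i : nat) : `|i%:R / m.+1%:R - i%:R / m.+1%:R| <= m.+1%:R^-1 :> R.
    by rewrite subrr normr0 invr_ge0 ltW.
  have dist1 (i : nat) : `|i.+1%:R / m.+1%:R - i%:R / m.+1%:R| <= m.+1%:R^-1 :> R.
    by rewrite step_norm.
  have dist2 (i : nat) : `|i%:R / m.+1%:R - i.+1%:R / m.+1%:R| <= m.+1%:R^-1 :> R.
    by rewrite distrC step_norm.
  have h := @chain_slide (row j) (row j.+1) delta y delta0 m 0%N.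
  rewrite !rowx// (saa_id mu_action) !add0n !rowy// in h.
  have {}h := h erefl erefl.
  apply: ucloseW (h _ _ _) => {h}; last first.
  - by move=> i im; apply: row_close; rewrite // ?ltnS// leqW.
  - by move=> i im; apply: row_close; rewrite // ?ltnS// leqW.
  - by move=> i im; apply: row_close; rewrite // ?ltnS// leqW.
  have delta_k : delta <= k by rewrite ler_pdivrMr// ler_peMr// ler1n.
  rewrite -mulrA; apply: ler_wpM2l; first exact: ltW.
  apply: ler_pM; [exact: expR_ge0| | |].
  - by rewrite !mulr_ge0 ?powR_ge0 ?sumr_ge0// addr_ge0// mulr_ge0.
  - rewrite ler_expR -mulrA ler_wpM2l// /delta mulrAC ler_pdivrMr//.
    by rewrite ler_wpM2l// ler_nat.
  rewrite /W -!mulrA -powRM ?invr_ge0 ?(ltW m0)//.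
  apply: ler_wpM2r; first by rewrite mulr_ge0 ?powR_ge0 ?sumr_ge0.
  by rewrite lerD2l ler_wpM2l.
have rows j : (j <= m.+1)%N ->
    uclose (chain mu x [seq row 0%N i | i <- iota 1 m] y)
      (chain mu x [seq row j i | i <- iota 1 m] y)
      (j%:R * (m.+1%:R * (expR (L * k) * (W * m.+1%:R^-1 `^ (2 + eps))))).
  elim: j => [|j IH] jm; first by apply: uclose_refl; rewrite mul0r.
  rewrite -natr1 mulrDl mul1r.
  by apply: uclose_trans (IH (ltnW jm)) (row_step _ _).
have grid0 : grid g0 m = [seq row 0%N i | i <- iota 1 m].
  apply/eq_in_map => i; rewrite mem_iota => /andP[_ im].
  by rewrite /row mul0r H0//; apply: grid_mem; rewrite ltnW.
have grid1 : grid g1 m = [seq row m.+1 i | i <- iota 1 m].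
  apply/eq_in_map => i; rewrite mem_iota => /andP[_ im].
  by rewrite /row divff ?gt_eqF// H1//; apply: grid_mem; rewrite ltnW.
rewrite grid0 grid1; apply: ucloseW (rows m.+1 (leqnn _)).
rewrite powRD; last by rewrite (gt_eqF (addr_gt0 _ _)).
rewrite powR_mulrn ?invr_ge0 ?(ltW m0)// /D le_eqVlt; apply/orP; left; apply/eqP.
by field; rewrite nat1r gt_eqF.
Qed.

End PathTransport.

(** * Subdividing paths up to homotopy *)

Section Subpaths.
Context (R : realType) (P : metricType R).
Local Notation I := (@unit_interval R).

Lemma lip_class_eq (x y : P) (g g' : lpath x y) :
  (forall u, I u -> g u = g' u) -> lip_class g = lip_class g'.
Proof.
move=> gg'; apply/lip_classP.
have [H [LH H0 H1 Hy Hx]] := lipschitz_homotopic_refl g.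
by exists H; split => // t It; rewrite H1// gg'.
Qed.

(** Both sides are reparametrizations of [gamma] by paths of the convex set
    [[0, 1]] with the same endpoints: the homotopy is the affine one. *)
Lemma lip_class_subpath (gamma : R -> P) (hgamma : lipschitz_path gamma)
    (s r t : R) (hs : I s) (hr : I r) (ht : I t) :
  lip_class (subpath hgamma hs ht) =
  lip_mul (lip_class (subpath hgamma hs hr)) (lip_class (subpath hgamma hr ht)).
Proof.
rewrite lip_mulE; apply/lip_classP.
pose al u := s * u + t * (1 - u).
pose be u := if u <= 2^-1 then r * (2 * u) + t * (1 - 2 * u)
             else s * (2 * u - 1) + r * (1 - (2 * u - 1)).
pose th (q : R * R) := (1 - q.1) * al q.2 + q.1 * be q.2.
have [k k0 gk] := (Lip_finP (X := R^o) _ _).1 hgamma.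
have /andP[s0 s1] : 0 <= s <= 1 by rewrite -unit_intervalE.
have /andP[r0 r1] : 0 <= r <= 1 by rewrite -unit_intervalE.
have /andP[t0 t1] : 0 <= t <= 1 by rewrite -unit_intervalE.
have al01 u : 0 <= u <= 1 -> 0 <= al u <= 1.
  by move=> /andP[u0 u1]; rewrite /al; apply/andP; split; nra.
have be01 u : 0 <= u <= 1 -> 0 <= be u <= 1.
  move=> /andP[u0 u1]; rewrite /be; case: (leP u 2^-1) => u2; apply/andP; split; nra.
have norm_mul (c d : R) : -1 <= c <= 1 -> `|c * d| <= `|d|.
  by move=> c1; rewrite normrM ler_piMl// ler_norml.
have al_lip u v : `|al u - al v| <= `|u - v|.
  rewrite (_ : al u - al v = (s - t) * (u - v)); last by rewrite /al; ring.
  by apply: norm_mul; lra.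
have be_lip u v : u <= v -> `|be u - be v| <= 2 * (v - u).
  move=> uv; rewrite /be; case: (leP u 2^-1) => u2; case: (leP v 2^-1) => v2.
  - rewrite (_ : _ - _ = (t - r) * (2 * (v - u))); last by ring.
    by apply: le_trans (norm_mul _ _ _) _; [lra|rewrite ger0_norm; lra].
  - rewrite (_ : _ - _ = (t - r) * (1 - 2 * u) + (r - s) * (2 * v - 1)); last by ring.
    apply: le_trans (ler_normD _ _) _.
    apply: le_trans (lerD (norm_mul _ _ _) (norm_mul _ _ _)) _; [lra|lra|].
    by rewrite !ger0_norm; lra.
  - by exfalso; lra.
  - rewrite (_ : _ - _ = (r - s) * (2 * (v - u))); last by ring.
    by apply: le_trans (norm_mul _ _ _) _; [lra|rewrite ger0_norm; lra].
have {}be_lip u v : `|be u - be v| <= 2 * `|u - v|.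
  have [uv|/ltW vu] := leP u v.
    by rewrite [`|u - v|]distrC [`|v - u|]ger0_norm ?subr_ge0// be_lip.
  by rewrite distrC [`|u - v|]ger0_norm ?subr_ge0// be_lip.
have thI q : unit_square q -> I (th q).
  case: q => c u [/=]; rewrite !unit_intervalE => /andP[c0 c1] u01.
  have /andP[a0 a1] := al01 _ u01; have /andP[b0 b1] := be01 _ u01.
  by rewrite /th /=; apply/andP; split; nra.
exists (gamma \o th); split => /=.
- apply/(Lip_finP (X := (R^o * R^o)%type)); exists (k * 3).
    by rewrite mulr_ge0.
  move=> q q' Iq Iq'; apply: le_trans (gk _ _ (thI _ Iq) (thI _ Iq')) _.
  rewrite -mulrA; apply: ler_wpM2l => //.
  case: q q' Iq Iq' => c u [c' u'] [/= Ic Iu] [/= Ic' Iu'].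
  move: Ic Iu Ic' Iu'; rewrite !unit_intervalE => /andP[c0 c1] u01 c'01 u'01.
  rewrite prod_normE /=.
  rewrite (_ : th (c, u) - th (c', u') = (1 - c) * (al u - al u') +
    c * (be u - be u') + (be u' - al u') * (c - c')); last by rewrite /th /=; ring.
  apply: le_trans (ler_normD _ _) _.
  have h1 : `|(be u' - al u') * (c - c')| <= `|c - c'|.
    apply: norm_mul; have /andP[a0 a1] := al01 _ u'01.
    by have /andP[b0 b1] := be01 _ u'01; lra.
  have h2 : `|(1 - c) * (al u - al u') + c * (be u - be u')| <= 2 * `|u - u'|.
    apply: le_trans (ler_normD _ _) _; rewrite !normrM.
    rewrite [`|1 - c|]ger0_norm ?subr_ge0// [`|c|]ger0_norm//.
    have := al_lip u u'; have := be_lip u u'; have := normr_ge0 (u - u').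
    by move: `|_| `|_| `|_| => x1 x2 x3; nra.
  have : `|c - c'| <= Num.max `|c - c'| `|u - u'| by rewrite le_max lexx.
  have : `|u - u'| <= Num.max `|c - c'| `|u - u'| by rewrite le_max lexx orbT.
  by lra.
- by move=> u _; rewrite /th /= subr0 mul1r mul0r addr0.
- move=> u _; rewrite /th /= subrr mul0r mul1r add0r /be /concat /=.
  by case: ifP.
- move=> c _; rewrite /th /al /be /= invr_ge0 ler0n; congr gamma; ring.
- move=> c _; rewrite /th /al /be /= ifF; last by apply/negbTE; rewrite -ltNge; lra.
  by congr gamma; ring.
Qed.

End Subpaths.

(** * Uniqueness and the groupoid action *)

Section Uniqueness.
Context (R : realType) (P : metricType R) (M : P -> pseudoMetricType R).
Variable mu : forall x y : P, M y -> M x.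
Variables (L eps : R) (n : nat) (a b C : 'I_n -> R).
Hypothesis M_complete : forall x : P, complete_extended_metric (M x).
Hypothesis mu_action : strongly_approximate_action mu L eps a b C.
Local Notation I := (@unit_interval R).

(** The values of the action on subpaths form a multiplicative family close to
    [mu], so they are close to the compositions along every subdivision. *)
Lemma action_is_transport (psi : forall x y : P, lip_groupoid x y -> M y -> M x)
    x y (g : lpath x y) :
  continuous_action psi -> approximated_by mu eps psi ->
  is_transport mu g (psi x y (lip_class g)).
Proof.
move=> psi_action psi_mu; have Lg := lpath_lipschitz g.
have L0 := saa_L_ge0 mu_action; have eps0 := saa_eps_gt0 mu_action.
have [C' hC'] := psi_mu _ Lg.
pose w u := g (1 - u); pose k := fine (Lip I g).
have k0 : 0 <= k by exact: fine_Lip_ge0.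
(* subpaths have parameters in the unit interval, hence the case distinction *)
pose S (u v : R) : M (w v) -> M (w u) :=
  match pselect (I (1 - u)), pselect (I (1 - v)) with
  | left hu, left hv => psi _ _ (lip_class (subpath Lg hu hv))
  | _, _ => @mu (w u) (w v)
  end.
have SE u v (hu : I (1 - u)) (hv : I (1 - v)) :
    S u v = psi _ _ (lip_class (subpath Lg hu hv)).
  rewrite /S; case: pselect => // hu'; case: pselect => // hv'.
  by congr (psi _ _); exact: lip_class_eq.
have Ic u : 0 <= u -> u <= 1 -> I (1 - u) by rewrite unit_intervalE; lra.
have q1 : 1 < 1 + eps by rewrite ltrDl.
pose T u v : M (w v) -> M (w u) := @mu (w u) (w v).
have T_lip u v : 0 <= u -> u <= v -> v <= 1 ->
    lip_bound (T u v) (expR (L * k * (v - u))).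
  move=> u0 uv v1.
  apply: lip_boundW (@mu_lip _ _ _ _ _ _ _ _ _ _ M_complete mu_action (w u) (w v)).
  rewrite ler_expR -mulrA ler_wpM2l//.
  apply: le_trans (mdist_le_Lip Lg _ _) _; [apply: Ic; lra|apply: Ic; lra|].
  rewrite (_ : 1 - u - (1 - v) = v - u); last by ring.
  by rewrite ger0_norm// subr_ge0.
have Lk0 : 0 <= L * k by rewrite mulr_ge0.
have rate m : uclose (psi x y (lip_class g)) (chain mu x (grid g m) y)
    (`|C'| * expR (L * k * (1 - 0)) * m.+1%:R^-1 `^ eps).
  have [I1 I0] : I (1 - 0) /\ I (1 - 1) by split; apply: Ic.
  have h := @multiplicative_close_rchain R (fun u => M (w u)) T (L * k) (1 + eps)
    Lk0 q1 T_lip (fun r => 0 <= r <= 1) S `|C'| m.+1%:R^-1 0 1 (unif 0 1 m)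
    (normr_ge0 _) (lexx _) (lexx _) _ _
    (unif_path_inv m ler01 _) _.
  have {h} : uclose (S 0 1) (rchain T 0 (unif 0 1 m) 1)
      (`|C'| * expR (L * k * (1 - 0)) * (m.+1%:R^-1 `^ eps)).
    apply: ucloseW (h _ _ _ _) => {h}.
    - by rewrite (_ : 1 + eps - 1 = eps) ?subr0 ?mulr1//; ring.
    - move=> u r u0 ur r1 _.
      rewrite (SE u 1 (Ic u u0 (le_trans ur r1)) I0).
      rewrite (SE u r (Ic u u0 (le_trans ur r1)) (Ic r (le_trans u0 ur) r1)).
      rewrite (SE r 1 (Ic r (le_trans u0 ur) r1) I0).
      by rewrite (lip_class_subpath _ _ (Ic r (le_trans u0 ur) r1)) (action_mul psi_action).
    - move=> u v u0 uv v1.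
      have Iu := Ic u u0 (le_trans uv v1); have Iv := Ic v (le_trans u0 uv) v1.
      rewrite (SE u v Iu Iv); apply: ucloseW (uclose_dist_sup (hC' _ _ Iu Iv)).
      rewrite (_ : 1 - v - (1 - u) = - (v - u)) ?normrN; last by ring.
      rewrite ger0_norm ?subr_ge0// ler_wpM2r ?powR_ge0//.
      apply: le_trans (ler_norm _) _; rewrite ler_peMr//.
      by rewrite -expR0 ler_expR mulr_ge0// subr_ge0.
    - by rewrite subr0.
    - by move=> r /(le_path_mem (step_path_le (unif_path m ler01))).
  have rchainE ts u v : rchain T u ts v = chain mu (w u) (map w ts) (w v).
    by elim: ts u => [|r ts IH] u //=; rewrite IH.
  rewrite rchainE (SE 0 1 I1 I0).
  have -> : map w (unif 0 1 m) = grid g m.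
    rewrite /unif /grid -map_comp; apply: eq_map => i /=.
    by rewrite /w subr0 mul1r add0r.
  have endpoints x' y' (g' : lpath x' y') l D : x' = x -> y' = y ->
      (forall u, I u -> g' u = g u) ->
      uclose (psi _ _ (lip_class g')) (chain mu x' l y') D ->
      uclose (psi _ _ (lip_class g)) (chain mu x l y) D.
    move=> ex ey; move: g'; rewrite ex ey => g' g'g.
    by rewrite (lip_class_eq g'g).
  apply: (endpoints _ _ (subpath Lg I1 I0)).
  - by rewrite subr0 lpath_range.
  - by rewrite subrr lpath_source.
  - by move=> u _ /=; congr (lpath_fun g _); ring.
move=> e e0; pose A := `|C'| * expR (L * k * (1 - 0)).
have : (fun m => A * (m.+1%:R^-1 : R) `^ eps) @ \oo --> A * 0.
  by apply: cvgM; [exact: cvg_cst|exact: powR_harmonic_cvg0].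
rewrite mulr0 => /cvgr_le/(_ _ e0)[N _ hN]; exists N => m Nm.
by apply: ucloseW (rate m); exact: hN.
Qed.

End Uniqueness.

Theorem theorem4p14 (R : realType) (P : metricType R)
  (M : P -> pseudoMetricType R)
  (M_complete : forall x : P, complete_extended_metric (M x))
  (mu : forall x y : P, M y -> M x)
  (L eps : R) (n : nat) (a b C : 'I_n -> R)
  (mu_action : strongly_approximate_action mu L eps a b C) :
  exists phi : forall x y : P, lip_groupoid x y -> M y -> M x,
    continuous_action phi /\
    approximated_by mu eps phi /\
    (forall psi : forall x y : P, lip_groupoid x y -> M y -> M x,
       continuous_action psi -> approximated_by mu eps psi -> psi = phi) /\
    (forall (gamma : R -> P) (hgamma : lipschitz_path gamma) (s t : R)
       (hs : unit_interval s) (ht : unit_interval t),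
       let phi_st := phi _ _ (lip_class (subpath hgamma hs ht)) in
       let Lip_gamma := fine (Lip (@unit_interval R) gamma) in
       (forall eta : R, 0 < eta -> exists2 delta : R, 0 < delta &
          forall ts : seq R, subdivision s ts t -> mesh s ts t < delta ->
            (dist_sup phi_st (chain mu (gamma s) (map gamma ts) (gamma t))
               < eta%:E)%E) /\
       (dist_sup phi_st (mu (gamma s) (gamma t)) <=
         (2 `^ (1 + eps) * expR (L * Lip_gamma * `|t - s|) *
          (\sum_(i < n) C i) * zeta (2 + eps) * Lip_gamma `^ (2 + eps) *
          `|t - s| `^ (1 + eps))%:E)%E /\
       (Lip setT phi_st <= (expR (L * Lip_gamma * `|t - s|))%:E)%E).
Proof.
have eps0 := saa_eps_gt0 mu_action; have L0 := saa_L_ge0 mu_action.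
pose ex x y (g : lip_groupoid x y) := lpath_transport M_complete mu_action (repr g).
pose phi x y (g : lip_groupoid x y) := projT1 (cid (ex x y g)).
have phi_repr x y (g : lip_groupoid x y) : is_transport mu (repr g) (phi x y g).
  by case: (projT2 (cid (ex x y g))).
have phi_class x y (g : lpath x y) : is_transport mu g (phi x y (lip_class g)).
  apply: (is_transport_homotopic M_complete mu_action _ (phi_repr _ _ (lip_class g))).
  by apply/lip_classP; rewrite /lip_class reprK.
have uniq x y := @is_transport_uniq _ _ _ mu M_complete x y.
pose bound k l := expR (L * k * l) * ((\sum_(i < n) C i) * (k * l) `^ (2 + eps)).
have phi_path (gamma : R -> P) (hgamma : lipschitz_path gamma) s t
    (hs : unit_interval s) (ht : unit_interval t) :
    let S := phi _ _ (lip_class (subpath hgamma hs ht)) in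
    let k := fine (Lip (@unit_interval R) gamma) in
    exists2 A, 0 <= A &
    [/\ forall d ts, monotone_steps d s ts t ->
          uclose S (chain mu (gamma s) (map gamma ts) (gamma t))
            (A * d `^ (1 + eps)),
        uclose S (@mu (gamma s) (gamma t)) (bound k `|t - s|) &
        lip_bound S (expR (L * k * `|t - s|))].
  move=> S k.
  have [S' [A A0 [rate near lip]]] := path_transport M_complete mu_action hgamma hs ht.
  have -> : S = S'.
    apply: uniq (phi_class _ _ _) _.
    exact: (subpath_is_transport mu_action A0 hs ht rate).
  by exists A.
have l01 (s t : R) : unit_interval s -> unit_interval t -> 0 <= `|t - s| <= 1.
  rewrite !unit_intervalE normr_ge0 /= => /andP[s0 s1] /andP[t0 t1].
  by rewrite ler_norml; lra.
have bound_le k l : 0 <= k -> 0 <= (\sum_(i < n) C i) * k `^ (2 + eps) ->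
    0 <= l <= 1 ->
    0 <= bound k l <= 2 `^ (1 + eps) * expR (L * k * l) *
      (\sum_(i < n) C i) * zeta (2 + eps) * k `^ (2 + eps) * l `^ (1 + eps).
  move=> k0 W0 /andP[l0 l1].
  rewrite /bound powRM// [in X in 0 <= X](mulrA (\sum_i C i)).
  apply/andP; split.
    by rewrite mulr_ge0 ?expR_ge0// mulr_ge0 ?powR_ge0.
  have l_pow : l `^ (2 + eps) <= l `^ (1 + eps).
    have [->|l_neq0] := eqVneq l 0.
      by rewrite !powR0// gt_eqF// addr_gt0.
    apply: ger_powR; first by rewrite lt_def l_neq0 l0.
    by rewrite lerD2r ler1n.
  have two : 1 <= 2 `^ (1 + eps) :> R.
    by rewrite -[leLHS](powRr0 2) ler_powR ?ler1n// addr_ge0// ltW.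
  have z1 : 1 <= zeta (2 + eps) by apply: zeta_ge1; rewrite lerDl ltW.
  have tz : 1 <= 2 `^ (1 + eps) * zeta (2 + eps) by rewrite mulr_ege1.
  rewrite [leLHS](_ : _ = expR (L * k * l) * ((\sum_i C i) * k `^ (2 + eps)) *
    l `^ (2 + eps)); last by ring.
  rewrite [leRHS](_ : _ = 2 `^ (1 + eps) * zeta (2 + eps) *
    (expR (L * k * l) * ((\sum_i C i) * k `^ (2 + eps)) * l `^ (1 + eps)));
    last by ring.
  have V0 : 0 <= expR (L * k * l) * ((\sum_i C i) * k `^ (2 + eps)).
    by rewrite mulr_ge0 ?expR_ge0.
  apply: (@le_trans _ _ (expR (L * k * l) * ((\sum_i C i) * k `^ (2 + eps)) *
    l `^ (1 + eps))); first by rewrite ler_wpM2l.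
  by rewrite ler_peMl// mulr_ge0// powR_ge0.
exists phi; split; [|split; [|split]].
- split.
  + move=> x; apply: uniq (phi_class _ _ _) _; exact: is_transport_const mu_action x.
  + move=> x y z g g'.
    exact: (is_transport_concat M_complete mu_action (phi_repr _ _ g)
      (phi_repr _ _ g') (phi_class _ _ (lpath_concat (repr g) (repr g')))).
  + move=> x y g; have [K K0 lip] := is_transport_lip M_complete mu_action (phi_repr _ _ g).
    exact: lip_bound_continuous K0 lip.
- move=> gamma hgamma; set k := fine (Lip (@unit_interval R) gamma).
  exists (2 `^ (1 + eps) * expR (L * k) * (\sum_(i < n) C i) * zeta (2 + eps) *
    k `^ (2 + eps)) => s t hs ht.
  have l_01 := l01 _ _ hs ht; have [l0 l1] := andP l_01.
  have [A A0 [_ near _]] := phi_path gamma hgamma s t hs ht.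
  have /andP[b0 b1] := bound_le _ _ (fine_Lip_ge0 gamma)
    (sum_coef_Lip_ge0 mu_action hgamma) l_01.
  apply: le_trans ((dist_supP _ _ b0).2 near) _; rewrite lee_fin.
  apply: le_trans b1 _; apply: ler_wpM2r; first exact: powR_ge0.
  have W0 := sum_coef_Lip_ge0 mu_action hgamma; rewrite -/k in W0 *.
  have z0 : 0 <= zeta (2 + eps).
    by apply: le_trans ler01 (zeta_ge1 _); rewrite lerDl ltW.
  rewrite [leLHS](_ : _ = 2 `^ (1 + eps) * zeta (2 + eps) *
    ((\sum_(i < n) C i) * k `^ (2 + eps)) * expR (L * k * `|t - s|)); last by ring.
  rewrite [leRHS](_ : _ = 2 `^ (1 + eps) * zeta (2 + eps) *
    ((\sum_(i < n) C i) * k `^ (2 + eps)) * expR (L * k)); last by ring.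
  apply: ler_wpM2l; first by rewrite mulr_ge0// mulr_ge0// powR_ge0.
  by rewrite ler_expR ler_piMr// mulr_ge0// fine_Lip_ge0.
- move=> psi psi_action psi_mu.
  do 2 apply: functional_extensionality_dep => ?.
  apply/funext => g.
  apply: uniq (phi_repr _ _ g).
  have := action_is_transport M_complete mu_action (repr g) psi_action psi_mu.
  by rewrite /lip_class reprK.
- move=> gamma hgamma s t hs ht phi_st k.
  have l_01 := l01 _ _ hs ht.
  have [A A0 [rate near lip]] := phi_path gamma hgamma s t hs ht.
  split; [|split].
  + move=> eta eta0; have eta20 : 0 < eta / 2 by rewrite divr_gt0.
    have [N hN] := rate_cvg0 mu_action A0 eta20.
    exists (N.+1%:R^-1) => [|ts sub_ts /ltW mesh_ts]; first by rewrite invr_gt0.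
    apply: (@le_lt_trans _ _ (eta / 2)%:E); last by rewrite lte_fin; lra.
    apply/dist_supP; first exact: ltW.
    apply: ucloseW (rate _ _ (subdivision_monotone sub_ts mesh_ts)).
    exact/ltW/hN.
  + have /andP[b0 b1] := bound_le _ _ (fine_Lip_ge0 gamma)
    (sum_coef_Lip_ge0 mu_action hgamma) l_01.
    by apply: le_trans ((dist_supP _ _ b0).2 near) _; rewrite lee_fin.
  + apply/lip_boundP; [by case: (M_complete (gamma t))|exact: expR_gt0|exact: lip].
Qed.
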